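(* Let $(M,g)$ be a pseudo-Riemannian manifold of signature $(2p,2q)$ and dimension $2n\ge4$ with Levi Civita connection $\nabla$. Consider the condition $$(\ast)\qquad\operatorname{Tr}_{\mathbb R}\big(R^\nabla_p(jX,jY)\circ j\big)=\operatorname{Tr}_{\mathbb R}\big(R^\nabla_p(X,Y)\circ j\big)\quad\forall p\in M,\ X,Y\in T_pM,\ j\in J(M,g)_p,$$ i.e. the condition that the almost complex structures $J^\pm_\nabla$ on the twistor space $J(M,g)$ are compatible with the closed $2$-form $\omega^{J(M,g,\nabla)}$. (1) If $M$ is non-oriented and $2n\ge4$, or $M$ is oriented and $2n\ge6$, then $(\ast)$ holds if and only if the Weyl component $C^\nabla$ of the curvature $R^\nabla$ vanishes. (2) If $M$ is oriented and $2n=4$, then $(\ast)$ holds if and only if the Weyl component of the Riemann curvature tensor is self-dual when the signature is $(4,0)$ or $(0,4)$, and anti-self-dual when the signature is $(2,2)$.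
   Context: Setting. Let $n=p+q$, $V=\mathbb{R}^{2n}$ with metric $\tilde g_0=\begin{pmatrix}I_{p,q}&0\\0&I_{p,q}\end{pmatrix}$, $I_{p,q}=\begin{pmatrix}I_p&0\\0&-I_q\end{pmatrix}$, and $\tilde j_0=\begin{pmatrix}0&-\mathrm{Id}_n\\\mathrm{Id}_n&0\end{pmatrix}$. A frame at $p\in M$ is a linear isometry $\xi\colon(V,\tilde g_0)\to(T_pM,g_p)$, required to send the standard basis of $\mathbb{R}^{2n}$ to a positively oriented basis if an orientation is given (''non-oriented'' means no orientation is given and all frames are used); $F(M,g)$ is the bundle of frames. The twistor bundle $\pi\colon J(M,g)\to M$ has as fibre $J(M,g)_p$ over $p$ the set of complex structures on $T_pM$ of the form $j=\xi\circ\tilde j_0\circ\xi^{-1}$ with $\xi$ a frame at $p$; $\pi_1(\xi)=\xi\circ\tilde j_0\circ\xi^{-1}$. The vertical space $\mathscr{V}_j=\operatorname{Ker}\pi_{*j}$ is identified with $\{S\in\operatorname{End}(T_pM): Sj+jS=0,\ g_p(SX,Y)+g_p(X,SY)=0\}$, $p=\pi(j)$. The horizontal space $\mathcal{H}^\nabla_j$ is the image under $\pi_{1*\xi}$ (any $\xi$ with $\pi_1(\xi)=j$) of the $\nabla$-horizontal subspace of $T_\xi F(M,g)$. Then $T_jJ(M,g)=\mathcal{H}^\nabla_j\oplus\mathscr{V}_j$ and $\mathcal{H}^\nabla_j\simeq T_{\pi(j)}M$ via $\pi_*$; $P^{\mathscr{V}}$ is the projection on $\mathscr{V}$ along $\mathcal{H}^\nabla$.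 Define $(J^\pm_\nabla)_j(S)=j\circ S$ for $S\in\mathscr{V}_j$, and $J^\pm_\nabla=\pm j$ on $\mathcal{H}^\nabla_j\simeq T_{\pi(j)}M$. The closed $2$-form is $$\omega^{J(M,g,\nabla)}_j(\Xi,\Xi')=-2\operatorname{Tr}_{\mathbb R}\big(R^\nabla_{\pi(j)}(\pi_{*j}\Xi,\pi_{*j}\Xi')\circ j\big)+i\operatorname{Tr}_{\mathbb C}\big([P^{\mathscr V}(\Xi),P^{\mathscr V}(\Xi')]\big),$$ where $\operatorname{Tr}_{\mathbb C}$ is the complex trace on $(T_{\pi(j)}M,j)$ and $R^\nabla(X,Y)=[\nabla_X,\nabla_Y]-\nabla_{[X,Y]}$. $J^\pm_\nabla$ is compatible with $\omega^{J(M,g,\nabla)}$ if $\omega^{J(M,g,\nabla)}(J^\pm_\nabla\Xi,J^\pm_\nabla\Xi')=\omega^{J(M,g,\nabla)}(\Xi,\Xi')$ for all $\Xi,\Xi'$, i.e. $\omega^{J(M,g,\nabla)}$ is of type $(1,1)$ with respect to $J^\pm_\nabla$; for each sign this is equivalent to $(\ast)$. The Weyl component $C^\nabla$ is the totally trace-free part of $R^\nabla$. In dimension $4$ with an orientation, a Weyl tensor is self-dual (resp. anti-self-dual) if, viewed as an endomorphism of $\Lambda^2T^*M$, it vanishes on the eigenspace of eigenvalue $-1$ (resp. $+1$) of the Hodge operator $*$ (with $\alpha\wedge*\beta=g(\alpha,\beta)\,\mathrm{vol}$). *)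

(* Defs.v *)
From HB Require Import structures.
From mathcomp Require Import all_boot all_order all_algebra.
From mathcomp Require Import all_classical all_reals all_analysis.
From mathcomp Require Import complex ring.

Set Implicit Arguments.
Unset Strict Implicit.
Unset Printing Implicit Defensive.

Import Order.TTheory GRing.Theory Num.Theory.
Import numFieldNormedType.Exports.

Local Open Scope classical_set_scope.
Local Open Scope ring_scope.

(* Tensors on a manifold are given, in the classical way, by their components
   in every chart together with the transformation rule between charts.  A
   tangent vector at a point of a chart is its column vector of components,
   an endomorphism of the tangent space is the matrix acting on columns, and
   a bilinear form b is the matrix of the b(d_i, d_k). *)

Section Smooth.
Variables (R : realType) (m : nat).

Definition basis_vec (i : 'I_m) : 'cV[R]_m := delta_mx i 0.

Definition partial (W : normedModType R) (i : 'I_m) (f : 'cV[R]_m -> W)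
  (x : 'cV[R]_m) : W := derive f x (basis_vec i).

Fixpoint Ck (W : normedModType R) (k : nat) (U : set 'cV[R]_m)
    (f : 'cV[R]_m -> W) : Prop :=
  (forall x, U x -> {for x, continuous f}) /\
  if k is k'.+1 then
    (forall i x, U x -> derivable f x (basis_vec i)) /\
    (forall i, Ck k' U (partial i f))
  else True.

Definition smooth (W : normedModType R) (U : set 'cV[R]_m)
  (f : 'cV[R]_m -> W) : Prop := forall k, Ck k U f.

Definition jacobian_mx (F : 'cV[R]_m -> 'cV[R]_m) (x : 'cV[R]_m) : 'M[R]_m :=
  \matrix_(l, i) partial i F x l 0.

End Smooth.

Record manifold (R : realType) (m : nat) := Manifold {
  mcarrier :> topologicalType;
  m_hausdorff : hausdorff_space mcarrier;
  m_second_countable : @second_countable mcarrier;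
  mindex : Type;
  dom : mindex -> set mcarrier;
  chart : mindex -> mcarrier -> 'cV[R]_m;
  chart_inv : mindex -> 'cV[R]_m -> mcarrier;
  dom_open : forall a, open (dom a);
  dom_cover : forall pt, exists a, dom a pt;
  chart_img_open : forall a, open (chart a @` dom a);
  chartK : forall a pt, dom a pt -> chart_inv a (chart a pt) = pt;
  chart_continuous : forall a pt, dom a pt -> {for pt, continuous (chart a)};
  chart_inv_continuous : forall a x, (chart a @` dom a) x ->
    {for x, continuous (chart_inv a)};
  transition_smooth : forall a b,
    smooth (chart a @` (dom a `&` dom b)) (chart b \o chart_inv a) }.

Section ManifoldNotions.
Variables (R : realType) (m : nat) (M : manifold R m).

Definition chart_img (a : mindex M) : set 'cV[R]_m := chart a @` dom a.

Definition overlap (a b : mindex M) : set 'cV[R]_m :=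
  chart a @` (dom a `&` dom b).

Definition transition (a b : mindex M) : 'cV[R]_m -> 'cV[R]_m :=
  chart b \o chart_inv a.

(* [oneg a pt] : the coordinate basis of chart [a] at [pt] is negatively
   oriented.  Charts may be orientation preserving on one component of their
   domain and reversing on another. *)
Record orientation := Orientation {
  oneg : mindex M -> M -> bool;
  oneg_locally_constant : forall a pt, dom a pt ->
    \forall pt' \near pt, oneg a pt' = oneg a pt;
  oneg_transition : forall a b pt, dom a pt -> dom b pt ->
    0 < (-1) ^+ oneg a pt * (-1) ^+ oneg b pt
        * \det (jacobian_mx (transition a b) (chart a pt)) }.

Definition osign (o : orientation) (a : mindex M) (pt : M) : R :=
  (-1) ^+ oneg o a pt.

(* [gamma a i x] is the matrix of v |-> nabla_(d_i) v on constant-component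
   fields, i.e. its (l, k) entry is the Christoffel symbol Gamma^l_(i k). *)
Record connection := Connection {
  gamma : mindex M -> 'I_m -> 'cV[R]_m -> 'M[R]_m;
  gamma_smooth : forall a i, smooth (chart_img a) (gamma a i);
  gamma_transition : forall a b i x, overlap a b x ->
    let J := jacobian_mx (transition a b) in
    J x *m gamma a i x =
      partial i J x + (\sum_s J x s i *: gamma b s (transition a b x)) *m J x }.

(* The matrix of [nabla_(d_i), nabla_(d_k)]; the bracket [d_i, d_k] is 0. *)
Definition curv_coord (D : connection) (a : mindex M) (x : 'cV[R]_m)
    (i k : 'I_m) : 'M[R]_m :=
  partial i (gamma D a k) x - partial k (gamma D a i) x
  + (gamma D a i x *m gamma D a k x - gamma D a k x *m gamma D a i x).

Definition curv (D : connection) (a : mindex M) (x X Y : 'cV[R]_m) : 'M[R]_m :=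
  \sum_i \sum_k (X i 0 * Y k 0) *: curv_coord D a x i k.

Definition gamma_vec (D : connection) (a : mindex M) (x X : 'cV[R]_m)
  : 'M[R]_m := \sum_i X i 0 *: gamma D a i x.

End ManifoldNotions.

Section ModelSpace.
Variables (R : realType) (p q : nat).

Definition Ipq : 'M[R]_(p + q) := block_mx 1%:M 0 0 (- 1%:M).

Definition g0 : 'M[R]_(p + q + (p + q)) := block_mx Ipq 0 0 Ipq.

Definition j0 : 'M[R]_(p + q + (p + q)) := block_mx 0 (- 1%:M) 1%:M 0.

End ModelSpace.

(* In an appropriate basis the metric is [g0], which has 2p signs + and 2q
   signs -. *)
Record pseudo_metric (R : realType) (p q : nat)
    (M : manifold R (p + q + (p + q))) := PseudoMetric {
  gmx : mindex M -> 'cV[R]_(p + q + (p + q)) -> 'M[R]_(p + q + (p + q));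
  gmx_smooth : forall a, smooth (chart_img a) (gmx a);
  gmx_sym : forall a x, chart_img a x -> (gmx a x)^T = gmx a x;
  gmx_signature : forall a x, chart_img a x ->
    exists2 xi, xi \in unitmx & xi^T *m gmx a x *m xi = g0 R p q;
  gmx_transition : forall a b x, overlap a b x ->
    let J := jacobian_mx (transition a b) x in
    gmx a x = J^T *m gmx b (transition a b x) *m J }.

Section TensorAlgebra.
(* G is the matrix of the metric at a point, Rm i j k l the tensor
   g(R(d_i, d_j) d_k, d_l). *)
Variables (R : realType) (m : nat) (G : 'M[R]_m).
Implicit Types (Rm C : 'I_m -> 'I_m -> 'I_m -> 'I_m -> R) (b c : 'M[R]_m).

(* Ric(Y, Z) = Tr (X |-> R(X, Y) Z). *)
Definition ricci Rm (j k : 'I_m) : R :=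
  \sum_i \sum_l invmx G i l * Rm i j k l.

Definition scalar_curv Rm : R := \sum_j \sum_k invmx G j k * ricci Rm j k.

Definition schouten Rm (j k : 'I_m) : R :=
  (ricci Rm j k - scalar_curv Rm / (2 * (m%:R - 1)) * G j k) / (m%:R - 2).

(* Subtracting from Rm the Kulkarni-Nomizu product of the metric with the
   Schouten tensor leaves its totally trace-free part. *)
Definition weyl Rm (i j k l : 'I_m) : R :=
  Rm i j k l - (schouten Rm i l * G j k + G i l * schouten Rm j k
                - schouten Rm i k * G j l - G i k * schouten Rm j l).

Definition two_form b : Prop := b^T = - b.

(* (1/2) C_(ij)^(kl) b_(kl). *)
Definition two_form_action C b : 'M[R]_m :=
  \matrix_(i, j) (2^-1 * \sum_k \sum_l
    C i j k l * (invmx G *m b *m (invmx G)^T) k l).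

(* Normalised by g(u /\ v, w /\ z) = g(u, w) g(v, z) - g(u, z) g(v, w), i.e.
   (1/2) b_(ij) c^(ij). *)
Definition two_form_inner b c : R :=
  2^-1 * \tr (b *m invmx G *m c^T *m (invmx G)^T).

Definition feval b (X Y : 'cV[R]_m) : R := (X^T *m b *m Y) 0 0.

Definition wedge b c (X0 X1 X2 X3 : 'cV[R]_m) : R :=
  feval b X0 X1 * feval c X2 X3 - feval b X0 X2 * feval c X1 X3
  + feval b X0 X3 * feval c X1 X2 + feval b X1 X2 * feval c X0 X3
  - feval b X1 X3 * feval c X0 X2 + feval b X2 X3 * feval c X0 X1.

(* s = 1 or -1 is the orientation of the coordinate basis. *)
Definition vol (s : R) (X : nat -> 'cV[R]_m) : R :=
  s * Num.sqrt `|\det G| * \det (\matrix_(i, k) X k i 0).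

(* c = * b, characterised by a /\ * b = g(a, b) vol.  Meant for m = 4, when
   [vol] depends only on the four vectors X 0, ..., X 3. *)
Definition is_hodge (s : R) b c : Prop :=
  two_form c /\
  forall a, two_form a -> forall X : nat -> 'cV[R]_m,
    wedge a c (X 0) (X 1) (X 2) (X 3) = two_form_inner a b * vol s X.

(* C vanishes on the eigenspace of * for the eigenvalue e. *)
Definition vanishes_on_eigenspace (s : R) C (e : R) : Prop :=
  forall b, two_form b -> is_hodge s b (e *: b) -> two_form_action C b = 0.

End TensorAlgebra.

(* The contractions over the other pairs of indices follow from this one by
   the symmetries of a curvature tensor. *)
Lemma weyl_trace_free (R : realType) (m : nat) (G : 'M[R]_m)
    (Rm : 'I_m -> 'I_m -> 'I_m -> 'I_m -> R) (j k : 'I_m) :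
  (2 < m)%N -> G \in unitmx -> G^T = G ->
  \sum_i \sum_l invmx G i l * weyl G Rm i j k l = 0.
Proof.
move=> m2 uG sG.
set H := invmx G; set P := schouten G Rm.
have HG i j' : \sum_l H i l * G l j' = (i == j')%:R.
  by have /matrixP/(_ i j') := mulVmx uG; rewrite !mxE.
have sH : H^T = H by rewrite /H trmx_inv sG.
have symG a b : G a b = G b a by rewrite -{1}sG mxE.
have symH a b : H a b = H b a by rewrite -{1}sH mxE.
have pick (F : 'I_m -> R) a : \sum_b (b == a)%:R * F b = F a.
  by rewrite (bigD1 a) //= eqxx mul1r big1 ?addr0// => b /negPf->; rewrite mul0r.
have trG : \sum_i \sum_l H i l * G i l = m%:R.
  rewrite (eq_bigr (fun=> 1)) ?sumr_const ?card_ord// => i _.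
  by rewrite (eq_bigr (fun l => H i l * G l i)) ?HG ?eqxx// => l _; rewrite (symG i).
have m1 : (m%:R - 1 : R) != 0.
  by rewrite subr_eq0 -[1]/(1%:R) eqr_nat; case: (m) m2 => [|[]].
have m2' : (m%:R - 2 : R) != 0.
  by rewrite subr_eq0 eqr_nat; case: (m) m2 => [|[|[]]].
have trP : \sum_i \sum_l H i l * P i l = scalar_curv G Rm / (2 * (m%:R - 1)).
  transitivity ((scalar_curv G Rm - scalar_curv G Rm / (2 * (m%:R - 1)) * m%:R)
                / (m%:R - 2)); last by field; rewrite m1 m2'.
  rewrite -{2}trG {1}/scalar_curv mulr_sumr -sumrB mulr_suml.
  apply: eq_bigr => i _; rewrite mulr_sumr -sumrB mulr_suml.
  by apply: eq_bigr => l _; rewrite /P /schouten -/H; ring.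
have t3 : \sum_i \sum_l H i l * (P i k * G j l) = P j k.
  rewrite -(pick (fun i => P i k)); apply: eq_bigr => i _.
  by rewrite -(HG i j) mulr_suml; apply: eq_bigr => l _; rewrite (symG j); ring.
have t4 : \sum_i \sum_l H i l * (G i k * P j l) = P j k.
  rewrite exchange_big -(pick (P j)); apply: eq_bigr => l _ /=.
  by rewrite -(HG l k) mulr_suml; apply: eq_bigr => i _; rewrite (symH l); ring.
transitivity (ricci G Rm j k - ((\sum_i \sum_l H i l * P i l) * G j k
   + (\sum_i \sum_l H i l * G i l) * P j k
   - \sum_i \sum_l H i l * (P i k * G j l)
   - \sum_i \sum_l H i l * (G i k * P j l))).
  rewrite !mulr_suml /ricci -/H -big_split -!sumrB; apply: eq_bigr => i _ /=.
  rewrite !mulr_suml -big_split -!sumrB; apply: eq_bigr => l _ /=.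
  by rewrite /weyl -/P; ring.
rewrite trP t3 t4 trG /P /schouten.
by field; rewrite m1 m2'.
Qed.

Section Twistor.
Variables (R : realType) (p q : nat) (M : manifold R (p + q + (p + q))).
Variables (g : pseudo_metric M) (D : connection M).
Local Notation m := (p + q + (p + q))%N.

Definition levi_civita : Prop :=
  forall (a : mindex M) (x : 'cV[R]_m), chart_img a x ->
    (forall i k l, gamma D a i x l k = gamma D a k x l i) /\
    (forall i, partial i (gmx g a) x =
       (gamma D a i x)^T *m gmx g a x + gmx g a x *m gamma D a i x).

Definition riemann_coord (a : mindex M) (x : 'cV[R]_m) (i j k l : 'I_m) : R :=
  (gmx g a x *m curv_coord D a x i j) l k.

Definition weyl_curv (a : mindex M) (pt : M) : 'I_m -> 'I_m -> 'I_m -> 'I_m -> R :=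
  weyl (gmx g a (chart a pt)) (riemann_coord a (chart a pt)).

Definition weyl_vanishes : Prop :=
  forall (pt : M) (a : mindex M), dom a pt ->
    forall i j k l, weyl_curv a pt i j k l = 0.

Definition weyl_self_dual (o : orientation M) : Prop :=
  forall (pt : M) (a : mindex M), dom a pt ->
    vanishes_on_eigenspace (gmx g a (chart a pt)) (osign o a pt)
      (weyl_curv a pt) (-1).

Definition weyl_anti_self_dual (o : orientation M) : Prop :=
  forall (pt : M) (a : mindex M), dom a pt ->
    vanishes_on_eigenspace (gmx g a (chart a pt)) (osign o a pt)
      (weyl_curv a pt) 1.

(* [o = None] : no orientation is given. *)
Variable o : option (orientation M).

Definition frame (a : mindex M) (pt : M) (xi : 'M[R]_m) : Prop :=
  [/\ xi \in unitmx,
      xi^T *m gmx g a (chart a pt) *m xi = g0 R p q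
    & if o is Some o' then 0 < osign o' a pt * \det xi else True].

Definition pi1 (xi : 'M[R]_m) : 'M[R]_m := xi *m j0 R p q *m invmx xi.

Definition twistor_fibre (a : mindex M) (pt : M) : set 'M[R]_m :=
  [set j | exists2 xi, frame a pt xi & j = pi1 xi].

Definition star_condition : Prop :=
  forall (pt : M) (a : mindex M), dom a pt ->
    forall (X Y : 'cV[R]_m) (j : 'M[R]_m), twistor_fibre a pt j ->
      let Rc := curv D a (chart a pt) in
      \tr (Rc (j *m X) (j *m Y) *m j) = \tr (Rc X Y *m j).

Definition vertical (a : mindex M) (pt : M) (j : 'M[R]_m) : set 'M[R]_m :=
  [set S | S *m j + j *m S = 0 /\
     S^T *m gmx g a (chart a pt) + gmx g a (chart a pt) *m S = 0].

(* Over a chart a point of J(M, g) is a pair (x, j) and a tangent vector at it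
   is the pair (X, A) of the velocities of x and j. *)
Definition tvec : Type := ('cV[R]_m * 'M[R]_m)%type.

(* The horizontal lift of X at the frame xi is (X, - gamma(X) xi), which
   pi1_* sends to (X, - [gamma(X), j]) for j = pi1 xi. *)
Definition hlift (a : mindex M) (pt : M) (j : 'M[R]_m) (X : 'cV[R]_m) : tvec :=
  let Gm := gamma_vec D a (chart a pt) X in (X, - (Gm *m j - j *m Gm)).

Definition vproj (a : mindex M) (pt : M) (j : 'M[R]_m) (Xi : tvec) : 'M[R]_m :=
  Xi.2 - (hlift a pt j Xi.1).2.

(* T_j J(M, g), the direct sum of the horizontal and vertical spaces. *)
Definition twistor_tangent (a : mindex M) (pt : M) (j : 'M[R]_m) : set tvec :=
  [set Xi | vertical a pt j (vproj a pt j Xi)].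

(* J^+ for [s = false], J^- for [s = true]. *)
Definition Jnabla (s : bool) (a : mindex M) (pt : M) (j : 'M[R]_m) (Xi : tvec)
    : tvec :=
  let H := hlift a pt j ((-1) ^+ s *: (j *m Xi.1)) in
  (H.1, H.2 + j *m vproj a pt j Xi).

(* The trace of a j-linear A : v_1, ..., v_n being a basis over C of the
   complex space, the real trace is computed in v_1, j v_1, ..., v_n, j v_n,
   so Tr_R A = 2 Re Tr_C A and Tr_R (A j) = 2 Re (i Tr_C A). *)
Definition trC (j A : 'M[R]_m) : R[i] :=
  Complex (\tr A / 2) (- \tr (A *m j) / 2).

Definition omega (a : mindex M) (pt : M) (j : 'M[R]_m) (Xi Xi' : tvec) : R[i] :=
  let S := vproj a pt j Xi in
  let S' := vproj a pt j Xi' in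
  Complex (- 2 * \tr (curv D a (chart a pt) Xi.1 Xi'.1 *m j)) 0
  + Complex 0 1 * trC j (S *m S' - S' *m S).

Definition compatible (s : bool) : Prop :=
  forall (pt : M) (a : mindex M), dom a pt ->
    forall j, twistor_fibre a pt j ->
    forall Xi Xi', twistor_tangent a pt j Xi -> twistor_tangent a pt j Xi' ->
      omega a pt j (Jnabla s a pt j Xi) (Jnabla s a pt j Xi')
      = omega a pt j Xi Xi'.

End Twistor.

(* Main.v *)
Require Import Defs.
From mathcomp Require Import all_boot all_order all_algebra.
From mathcomp Require Import all_classical all_reals all_analysis.
From mathcomp Require Import perm complex ring lra.
(** The condition is pointwise.  At a point, let G be the matrix of the metric,
    let e_1, ..., e_n, e_(n+1), ..., e_(2n) be a frame, with signs eps_i, and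
    let j be the complex structure with j e_a = e_(n+a).  Then
      Tr (R(X, Y) j) = - 2 * sum_a eps_a g(R(X, Y) e_a, e_(n+a)),
    that is, up to a factor, the curvature operator applied to the bivector
    sum_a eps_a e_a /\ e_(n+a) of j ([trace_star_form]).

    The part of R built from the Schouten tensor P contributes
    P(X, jY) - P(Y, jX) to the sum ([star_form_kulkarni]), which does not change
    when X, Y are replaced by jX, jY because P is symmetric.  So the condition
    only concerns the Weyl tensor C ([star_at_weyl]), and C = 0 implies it.

    For the converse, single out two of the planes <x, x'> and <y, y'> of j,
    with x' = jx and y' = jy, and rotate the frame in the plane <x, y>.  The
    condition becomes an identity between polynomials in the cosine and the
    sine (hyperbolic ones if x and y have opposite signs), whose coefficients
    vanish separately.  With j_U the bivector of j on U = <x, x', y, y'>,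
    k = x /\ y' + x' /\ y and k' = x /\ y - x' /\ y', this gives C(k, k') = 0
    and C(k, k) = C(k', k') = +- C(j_U, j_U) ([admissible_diagonal],
    [admissible_ck2k2]).  As k' + i k = (x + i x') /\ (y + i y'), part of this
    says that C(z, w, z, w) = 0 for z = x + i x' and w = y + i y', which span
    an isotropic plane.

    If n >= 3, the sign of a vector outside U can be changed to make a frame
    positively oriented, so the isotropic planes of all frames, oriented or
    not, are reached.  Permuting and rotating the frame turns the vanishing of
    C on them into symmetries which, with the Bianchi identity and trace
    freeness, force C = 0 ([isotropic_vanishing]).

    If n = 2, then U is the whole space, and j, k, k' span one of the two
    halves of the bivectors.  On this half C is scalar with respect to the
    invariant inner product, the Bianchi identity and trace freeness make the
    scalar vanish, and a trace free C does not mix the two halves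
    ([half_operator_vanishes]).  So C vanishes on this half, which for a
    positively oriented frame is the eigenspace of the Hodge operator for the
    eigenvalue - eps_1 eps_2 ([is_hodge_relations], [hodge_J]): -1 in the
    definite case, 1 in signature (2, 2).  Without an orientation both halves
    occur, hence C = 0 ([star_weyl_zero_four]).

    The algebra uses the symmetries of the Riemann tensor.  The first Bianchi
    identity comes from the symmetry of the Christoffel symbols, and the
    antisymmetry in the last two indices from the compatibility with the
    metric, since the second partial derivatives of the metric commute
    ([derive_commute]). *)

Set Implicit Arguments.
Unset Strict Implicit.
Unset Printing Implicit Defensive.
Import Order.TTheory GRing.Theory Num.Theory.
Import numFieldNormedType.Exports.
Local Open Scope classical_set_scope.
Local Open Scope ring_scope.

(** * Second partial derivatives commute *)
Section Schwarz.
Variables (R : realType) (V : normedModType R).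
Implicit Types (f : V -> R) (x u v : V).

Lemma is_derive_line f y u (s : R) (d : R) : is_derive (y + s *: u) u f d ->
  is_derive s 1 (fun s => f (y + s *: u)) d.
Proof.
move=> [df dE].
have E : (fun h : R => h^-1 *: (f (y + (h *: 1 + s) *: u) - f (y + s *: u))) =
         (fun h : R => h^-1 *: (f (h *: u + (y + s *: u)) - f (y + s *: u))).
  apply/funext => h; congr (_ *: (f _ - _)).
  by rewrite -[h *: 1]/(h * 1) mulr1 scalerDl addrCA.
by apply: DeriveDef; rewrite /derivable /derive /= E // -dE.
Qed.

Lemma mean_value_from0 (g dg : R -> R) (h : R) : 0 < h ->
  (forall s, 0 <= s <= h -> is_derive s 1 g (dg s)) ->
  exists2 c, 0 <= c <= h & g h - g 0 = dg c * h.
Proof.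
move=> h0 dg_; have [|//||c ch ->] := @MVT R g dg 0 h _ _.
- by [].
- move=> s; rewrite in_itv /= => /andP[s0 sh]; apply: dg_.
  by rewrite (ltW s0) (ltW sh).
- apply: derivable_within_continuous => s; rewrite in_itv /= => sh.
  by have := dg_ s sh; case.
- exists c; last by rewrite subr0.
  by move: ch; rewrite in_itv /= => /andP[/ltW -> /ltW ->].
Qed.

(** Two applications of the mean value theorem to the second difference over a
    square, first along u and then along v.  Exchanging u and v computes the
    same second difference from the other mixed derivative. *)
Lemma second_difference f fu fuv x u v (h : R) : 0 < h ->
  (forall s t, 0 <= s <= h -> 0 <= t <= h ->
     let y := x + s *: u + t *: v in
     is_derive y u f (fu y) /\ is_derive y v fu (fuv y)) ->
  exists s t, [/\ 0 <= s <= h, 0 <= t <= h &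
    f (x + h *: u + h *: v) - f (x + h *: u) - f (x + h *: v) + f x
    = fuv (x + s *: u + t *: v) * h ^+ 2].
Proof.
move=> h0 df; have hh : 0 <= h <= h by rewrite ltW ?lexx.
have zh : 0 <= (0 : R) <= h by rewrite lexx ltW.
pose g s := f (x + h *: v + s *: u) - f (x + s *: u).
pose dg s := fu (x + h *: v + s *: u) - fu (x + s *: u).
have [s sh|s sh Es] := @mean_value_from0 g dg h h0.
  apply: is_deriveB; apply: is_derive_line.
    by rewrite addrAC; apply: (df s h sh hh).1.
  by have := (df s 0 sh zh).1; rewrite scale0r addr0.
have [t th|t th Et] :=
  @mean_value_from0 (fun t => fu (x + s *: u + t *: v))
    (fun t => fuv (x + s *: u + t *: v)) h h0.
  by apply: is_derive_line; apply: (df s t sh th).2.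
exists s, t; split => //; rewrite expr2 mulrA -Et scale0r addr0.
move: Es; rewrite /g /dg scale0r !addr0.
by rewrite ![x + h *: v + _]addrAC => <-; ring.
Qed.

Lemma dist_half (A B C e : R) :
  `|A - C| <= e / 2 -> `|B - C| <= e / 2 -> `|A - B| <= e.
Proof. rewrite !ler_distl => /andP[? ?] /andP[? ?]; lra. Qed.

(** Schwarz's theorem.  Over small squares at x the second difference is both
    h^2 times a value of fuv and h^2 times a value of fvu, and both values tend
    to those at x. *)
Lemma derive_commute f fu fv fuv fvu x u v :
  (\forall y \near x, is_derive y u f (fu y)) ->
  (\forall y \near x, is_derive y v f (fv y)) ->
  (\forall y \near x, is_derive y v fu (fuv y)) ->
  (\forall y \near x, is_derive y u fv (fvu y)) ->
  {for x, continuous fuv} -> {for x, continuous fvu} ->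
  fuv x = fvu x.
Proof.
move=> Du Dv Duv Dvu cuv cvu; apply/eqP; rewrite -subr_eq0 -normr_le0.
apply/ler_addgt0Pr => e e0; rewrite add0r.
have e20 : 0 < e / 2 by rewrite divr_gt0.
have c1 : \forall y \near x, `|fuv x - fuv y| <= e / 2.
  by move/cvgrPdist_le : cuv; apply.
have c2 : \forall y \near x, `|fvu x - fvu y| <= e / 2.
  by move/cvgrPdist_le : cvu; apply.
have /nbhs_ballP[r /= r0 xr] : nbhs x
   ([set y | is_derive y u f (fu y)] `&` [set y | is_derive y v fu (fuv y)]
    `&` ([set y | is_derive y v f (fv y)] `&` [set y | is_derive y u fv (fvu y)])
    `&` ([set y | `|fuv x - fuv y| <= e / 2]
    `&` [set y | `|fvu x - fvu y| <= e / 2])).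
  exact: (filterI (filterI (filterI Du Duv) (filterI Dv Dvu)) (filterI c1 c2)).
(* a square of this side stays in the ball of radius r *)
set h := r / (2 * (`|u| + `|v| + 1)).
have N0 : 0 < `|u| + `|v| + 1 by rewrite ltr_wpDl// addr_ge0.
have h0 : 0 < h by rewrite divr_gt0// mulr_gt0.
have near_sq s t : 0 <= s <= h -> 0 <= t <= h -> ball x r (x + s *: u + t *: v).
  move=> /andP[s0 sh] /andP[t0 th]; rewrite -ball_normE /ball_ /=.
  rewrite -addrA opprD addrA subrr sub0r normrN.
  apply: le_lt_trans (ler_normD _ _) _; rewrite !normrZ !ger0_norm//.
  apply: (@le_lt_trans _ _ (h * (`|u| + `|v|))).
    by rewrite mulrDr lerD// ler_wpM2r.
  apply: (@lt_le_trans _ _ (h * (2 * (`|u| + `|v| + 1)))).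
    rewrite ltr_pM2l//.
    have := normr_ge0 u; have := normr_ge0 v; lra.
  by rewrite /h divfK// lt0r_neq0// mulr_gt0.
have d1 s t : 0 <= s <= h -> 0 <= t <= h ->
    let y := x + s *: u + t *: v in
    is_derive y u f (fu y) /\ is_derive y v fu (fuv y).
  move=> sh th; have [[[a b] _] _] := xr _ (near_sq _ _ sh th).
  exact: (conj a b).
have d2 s t : 0 <= s <= h -> 0 <= t <= h ->
    let y := x + s *: v + t *: u in
    is_derive y v f (fv y) /\ is_derive y u fv (fvu y).
  move=> sh th; rewrite addrAC.
  by have [[_ [a b]] _] := xr _ (near_sq _ _ th sh); exact: (conj a b).
have [s [t [sh th Es]]] := second_difference h0 d1.
have [t' [s' [th' sh' Et]]] := second_difference h0 d2.
have E : fuv (x + s *: u + t *: v) = fvu (x + s' *: u + t' *: v).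
  apply: (@mulIf _ (h ^+ 2)); first by rewrite expf_neq0// lt0r_neq0.
  by rewrite -Es [x + s' *: u + _]addrAC -Et [x + h *: v + _]addrAC; ring.
have a : `|fuv x - fuv (x + s *: u + t *: v)| <= e / 2.
  by have [_ [a _]] := xr _ (near_sq _ _ sh th); exact: a.
have b : `|fvu x - fvu (x + s' *: u + t' *: v)| <= e / 2.
  by have [_ [_ b]] := xr _ (near_sq _ _ sh' th'); exact: b.
rewrite E in a; exact: dist_half a b.
Qed.

Lemma is_derive_entry (m n : nat) (M : V -> 'M[R]_(m, n)) x v r c :
  derivable M x v -> is_derive x v (fun y => M y r c) (('D_v M x) r c).
Proof.
move=> dM; apply: DeriveDef; first by move/derivable_mxP: dM; apply.
by rewrite derive_mx// mxE.
Qed.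

Lemma is_derive_mulmx (m n k : nat) (M : V -> 'M[R]_(m, n))
    (N : V -> 'M[R]_(n, k)) x v :
  derivable M x v -> derivable N x v ->
  is_derive x v (fun y => M y *m N y) ('D_v M x *m N x + M x *m 'D_v N x).
Proof.
move=> dM dN.
have dE r c : is_derive x v (fun y => (M y *m N y) r c)
    (('D_v M x *m N x + M x *m 'D_v N x) r c).
  have -> : (fun y => (M y *m N y) r c)
          = \sum_s (fun y => M y r s) * (fun y => N y s c).
    by apply/funext => y; rewrite mxE fct_sumE.
  apply: is_derive_eq.
    apply: is_derive_sum => s.
    by apply: is_deriveM; apply: is_derive_entry.
  rewrite !mxE -big_split /=; apply: eq_bigr => s _.
  rewrite -[X in X + _ = _]/(M x r s * _) -[X in _ + X = _]/(N x s c * _).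
  by rewrite addrC [N x s c * _]mulrC.
have dMN : derivable (fun y => M y *m N y) x v.
  by apply/derivable_mxP => r c; case: (dE r c).
apply: DeriveDef => //; rewrite derive_mx//; apply/matrixP => r c.
by rewrite mxE; case: (dE r c).
Qed.

Lemma is_derive_trmx (m n : nat) (M : V -> 'M[R]_(m, n)) x v :
  derivable M x v -> is_derive x v (fun y => (M y)^T) (('D_v M x)^T).
Proof.
move=> dM.
have dE r c : is_derive x v (fun y => ((M y)^T) r c) ((('D_v M x)^T) r c).
  have -> : (fun y => ((M y)^T) r c) = (fun y => M y c r).
    by apply/funext => y; rewrite mxE.
  by rewrite mxE; apply: is_derive_entry.
have dT : derivable (fun y => (M y)^T) x v.
  by apply/derivable_mxP => r c; case: (dE r c).
apply: DeriveDef => //; rewrite derive_mx//; apply/matrixP => r c.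
by rewrite mxE; case: (dE r c).
Qed.

End Schwarz.

Section SmoothPartials.
Variables (R : realType) (m : nat) (U : set 'cV[R]_m).
Hypothesis oU : open U.

Lemma smooth_derivable (W : normedModType R) (f : 'cV[R]_m -> W) i x :
  smooth U f -> U x -> derivable f x (basis_vec R i).
Proof. by move=> /(_ 1%N)[_ [+ _]] Ux; apply. Qed.

Lemma partial_commute (f : 'cV[R]_m -> 'M[R]_m) i k x :
  smooth U f -> U x -> partial i (partial k f) x = partial k (partial i f) x.
Proof.
move=> sf Ux; apply/matrixP => r c.
have nU : \forall y \near x, U y by apply: open_nbhs_nbhs; split.
have [_ [df d2f]] := sf 2%N.
have D1 j : \forall y \near x, is_derive y (basis_vec R j)
   (fun y => f y r c) (partial j f y r c).
  by apply: filterS nU => y Uy; apply: is_derive_entry; apply: df.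
have D2 j l : \forall y \near x, is_derive y (basis_vec R l)
   (fun y => partial j f y r c) (partial l (partial j f) y r c).
  apply: filterS nU => y Uy; apply: is_derive_entry.
  by have [_ [+ _]] := d2f j; apply.
have C2 j l : {for x, continuous (fun y => partial l (partial j f) y r c)}.
  have [_ [_ /(_ l)[/(_ x Ux) cf _]]] := d2f j.
  by apply: (@continuous_comp _ _ _ _ (fun M : 'M[R]_m => M r c));
     [exact: cf|exact: coord_continuous].
exact: (@derive_commute _ _ _ _ _ _ _ x _ _ (D1 k) (D1 i) (D2 k i) (D2 i k)).
Qed.

End SmoothPartials.

(** * Symmetries of the Riemann tensor *)
(** The algebra behind the antisymmetry of the curvature.  With P and Q the
    partial derivatives of the connection matrices Gk and Gi, the hypothesis
    equates the two second partial derivatives of G computed from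
    dG = Gamma^T G + G Gamma.  The products of two connection matrices around G
    are symmetric in i and k and cancel. *)
Lemma skew_second_partials (R : realType) (n : nat) (G Gi Gk P Q : 'M[R]_n) :
  P^T *m G + Gk^T *m (Gi^T *m G + G *m Gi)
    + ((Gi^T *m G + G *m Gi) *m Gk + G *m P)
  = Q^T *m G + Gi^T *m (Gk^T *m G + G *m Gk)
    + ((Gk^T *m G + G *m Gk) *m Gi + G *m Q) ->
  (P - Q + (Gi *m Gk - Gk *m Gi))^T *m G
    + G *m (P - Q + (Gi *m Gk - Gk *m Gi)) = 0.
Proof.
rewrite !(mulmxDl, mulmxDr) => E.
rewrite !(raddfD, raddfN) /= !trmx_mul !(mulmxDl, mulmxDr, mulNmx, mulmxN).
move: E; rewrite !mulmxA.
move: (P^T *m G) (Q^T *m G) (G *m P) (G *m Q) (Gi^T *m Gk^T *m G)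
  (Gk^T *m Gi^T *m G) (Gi^T *m G *m Gk) (Gk^T *m G *m Gi) (G *m Gi *m Gk)
  (G *m Gk *m Gi) => x1 x2 x3 x4 x5 x6 x7 x8 x9 x10 /matrixP E.
apply/matrixP => r c; have := E r c; rewrite !mxE; lra.
Qed.

Section CurvatureSymmetries.
Variables (R : realType) (p q : nat) (M : manifold R (p + q + (p + q))).
Variables (g : pseudo_metric M) (D : connection M).
Local Notation m := (p + q + (p + q))%N.

Lemma gamma_derivable a i k x : chart_img a x ->
  derivable (gamma D a i) x (basis_vec R k).
Proof. exact: smooth_derivable (gamma_smooth D a i). Qed.

Lemma curv_coord_antisym a x i k :
  curv_coord D a x k i = - curv_coord D a x i k.
Proof. by rewrite /curv_coord opprD !opprB. Qed.

Hypothesis hD : levi_civita g D.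

Lemma near_chart a x : chart_img (M := M) a x ->
  \forall y \near x, chart_img (M := M) a y.
Proof.
by move=> Ux; apply: open_nbhs_nbhs; split=> //; apply: chart_img_open.
Qed.

(** The Christoffel symbols are symmetric on the whole chart domain, so their
    partial derivatives are symmetric too; the terms of the cyclic sum then
    cancel in pairs. *)
Lemma curv_coord_bianchi a x i j k l : chart_img a x ->
  curv_coord D a x i j l k + curv_coord D a x j k l i
  + curv_coord D a x k i l j = 0.
Proof.
move=> Ux.
pose A s r l c := (partial s (gamma D a r) x) l c.
pose B s r l c := (gamma D a s x *m gamma D a r x) l c.
have AC s r l' c : A s r l' c = A s c l' r.
  have E b : derivable (gamma D a b) x (basis_vec R s).
    exact: gamma_derivable.
  have dE b c' : A s b l' c' = 'D_(basis_vec R s) (fun y => gamma D a b y l' c') x.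
    by rewrite /A /partial derive_mx// mxE.
  rewrite !dE; apply: near_eq_derive.
  apply: filterS (near_chart Ux) => y Uy.
  by have [+ _] := hD Uy; apply.
have BC s r l' c : B s r l' c = B s c l' r.
  rewrite /B !mxE; apply: eq_bigr => u _.
  by congr (_ * _); have [+ _] := hD Ux; apply.
have E i' j' k' : curv_coord D a x i' j' l k'
    = A i' j' l k' - A j' i' l k' + (B i' j' l k' - B j' i' l k').
  by rewrite /curv_coord /A /B !mxE.
rewrite !E (AC j k) (BC j k) (AC k j) (BC k j) (AC i k) (BC i k).
ring.
Qed.

Lemma curv_coord_skew a x i k : chart_img a x ->
  (curv_coord D a x i k)^T *m gmx g a x + gmx g a x *m curv_coord D a x i k = 0.
Proof.
move=> Ux.
have dg s : derivable (gmx g a) x (basis_vec R s).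
  exact: smooth_derivable (gmx_smooth g a) Ux.
have D2 s r : partial s (partial r (gmx g a)) x =
   ((partial s (gamma D a r) x)^T *m gmx g a x
     + (gamma D a r x)^T *m partial s (gmx g a) x)
   + (partial s (gmx g a) x *m gamma D a r x
     + gmx g a x *m partial s (gamma D a r) x).
  rewrite {1}/partial (@near_eq_derive _ _ _ _
    (fun y => (gamma D a r y)^T *m gmx g a y + gmx g a y *m gamma D a r y)).
    apply: derive_val; apply: is_deriveD; last first.
      by apply: is_derive_mulmx; [exact: dg|exact: gamma_derivable].
    have dT : is_derive x (basis_vec R s) (fun y => (gamma D a r y)^T)
        ((partial s (gamma D a r) x)^T).
      by apply: is_derive_trmx; exact: gamma_derivable.
    rewrite -(@derive_val _ _ _ _ _ _ _ dT).
    by apply: is_derive_mulmx => //; case: dT.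
  apply: filterS (near_chart Ux) => y Uy.
  by have [_ +] := hD Uy; apply.
have D1 s : partial s (gmx g a) x
   = (gamma D a s x)^T *m gmx g a x + gmx g a x *m gamma D a s x.
  by have [_ +] := hD Ux; apply.
have := partial_commute (@chart_img_open _ _ M a) i k (gmx_smooth g a) Ux.
rewrite !D2 !D1 /curv_coord.
set G := gmx g a x; set Gi := gamma D a i x; set Gk := gamma D a k x.
set P := partial i _ x; set Q := partial k _ x.
exact: skew_second_partials.
Qed.
End CurvatureSymmetries.

(** * Algebraic curvature tensors *)
Section CurvatureForm.
Variables (R : realFieldType) (V : lmodType R).
Implicit Types (c : V -> V -> V -> V -> R) (x y z w : V).

(** Linearity is only required in the first variable: the symmetries carry it
    to the other three. *)
Record curvature_form c : Prop := CurvatureForm {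
  cfD : forall x x' y z w, c (x + x') y z w = c x y z w + c x' y z w;
  cfZ : forall a x y z w, c (a *: x) y z w = a * c x y z w;
  cf12 : forall x y z w, c y x z w = - c x y z w;
  cf34 : forall x y z w, c x y w z = - c x y z w;
  cfB : forall x y z w, c x y z w + c y z x w + c z x y w = 0 }.

Variables (c : V -> V -> V -> V -> R) (hc : curvature_form c).

(** The usual octahedron argument: adding the Bianchi identities that fix w and x
    and subtracting those that fix y and z leaves twice the difference of the
    two sides. *)
Lemma cf_pair x y z w : c z w x y = c x y z w.
Proof.
have B := cfB hc.
have := B x y z w; have := B y z w x; have := B z w x y; have := B w x y z.
have A := cf12 hc; have A' := cf34 hc.
have := A x z y w; have := A' y z x w; have := A' z w x y.
have := A y w z x; have := A' y w x z; have := A x w z y; have := A' x w y z.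
have := A' x z y w; have := A x w y z; have := A' x y z w; lra.
Qed.

Lemma cf_rev x y z w : c y x w z = c x y z w.
Proof. by rewrite (cf12 hc) (cf34 hc) opprK. Qed.

Lemma cfD2 x y y' z w : c x (y + y') z w = c x y z w + c x y' z w.
Proof. by rewrite !(cf12 hc _ x) (cfD hc) opprD. Qed.

Lemma cfZ2 a x y z w : c x (a *: y) z w = a * c x y z w.
Proof. by rewrite !(cf12 hc _ x) (cfZ hc) mulrN. Qed.

Lemma cfD3 x y z z' w : c x y (z + z') w = c x y z w + c x y z' w.
Proof. by rewrite -!(cf_pair x y) (cfD hc). Qed.

Lemma cfZ3 a x y z w : c x y (a *: z) w = a * c x y z w.
Proof. by rewrite -!(cf_pair x y) (cfZ hc). Qed.

Lemma cfD4 x y z w w' : c x y z (w + w') = c x y z w + c x y z w'.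
Proof. by rewrite -!(cf_pair x y) cfD2. Qed.

Lemma cfZ4 a x y z w : c x y z (a *: w) = a * c x y z w.
Proof. by rewrite -!(cf_pair x y) cfZ2. Qed.

Definition cfE := (cfD hc, cfD2, cfD3, cfD4, cfZ hc, cfZ2, cfZ3, cfZ4).

Lemma cf11 x z w : c x x z w = 0.
Proof. by have := cf12 hc x x z w; lra. Qed.

Lemma cf44 x y z : c x y z z = 0.
Proof. by have := cf34 hc x y z z; lra. Qed.

End CurvatureForm.

(** * Orthonormal frames and plane rotations *)
Section Frames.
Variables (R : realFieldType) (V : lmodType R) (g : V -> V -> R).
Hypothesis gC : forall x y, g x y = g y x.
Hypothesis gD : forall x y z, g (x + y) z = g x z + g y z.
Hypothesis gZ : forall a x z, g (a *: x) z = a * g x z.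
Variables (I : finType) (eps : I -> R).
Hypothesis eps2 : forall i, eps i * eps i = 1.

Definition orthoframe (e : I -> V) : Prop :=
  forall i j, g (e i) (e j) = eps i *+ (i == j).

(** A rotation in the plane of e_f and e_d if they have the same sign, and a
    boost otherwise; C and S are the circular or hyperbolic cosine and sine. *)
Definition rotate (e : I -> V) (f d : I) (C S : R) : I -> V := fun x =>
  if x == f then C *: e f + S *: e d
  else if x == d then (- (eps f * eps d * S)) *: e f + C *: e d else e x.

Definition flip (e : I -> V) (f : I) : I -> V := fun x =>
  if x == f then (-1) *: e f else e x.

Lemma rotate_f e f d C S : rotate e f d C S f = C *: e f + S *: e d.
Proof. by rewrite /rotate eqxx. Qed.

Lemma rotate_d e f d C S : f != d ->
  rotate e f d C S d = (- (eps f * eps d * S)) *: e f + C *: e d.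
Proof. by rewrite /rotate eq_sym => /negPf->; rewrite eqxx. Qed.

Lemma rotate_out e f d C S x : x != f -> x != d -> rotate e f d C S x = e x.
Proof. by rewrite /rotate => /negPf-> /negPf->. Qed.

Lemma flip_f e f : flip e f f = (-1) *: e f.
Proof. by rewrite /flip eqxx. Qed.

Lemma flip_out e f x : x != f -> flip e f x = e x.
Proof. by rewrite /flip => /negPf->. Qed.

Lemma gD2 x y z : g z (x + y) = g z x + g z y.
Proof. by rewrite !(gC z) gD. Qed.
Lemma gZ2 a x z : g z (a *: x) = a * g z x.
Proof. by rewrite !(gC z) gZ. Qed.

Lemma flip_frame e f : orthoframe e -> orthoframe (flip e f).
Proof.
move=> he i j.
have out x y : x != f -> g (e x) (flip e f y) = eps x *+ (x == y).
  move=> xf; have [E|yf] := boolP (y == f); last by rewrite flip_out// he.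
  by rewrite (eqP E) flip_f gZ2 he (negPf xf) mulr0.
have epsC x y : eps x *+ (x == y) = eps y *+ (y == x).
  by case: (eqVneq x y) => [->|].
have [Ei|ni] := boolP (i == f); last by rewrite {1}/flip (negPf ni) out.
have [Ej|nj] := boolP (j == f); last by rewrite gC {1}/flip (negPf nj) out// epsC.
rewrite (eqP Ei) (eqP Ej) flip_f gZ gZ2 he eqxx; ring.
Qed.

Lemma rotate_frame e f d C S : f != d -> C ^+ 2 + eps f * eps d * S ^+ 2 = 1 ->
  orthoframe e -> orthoframe (rotate e f d C S).
Proof.
move=> fd CS he.
have E x y : x != y -> g (e x) (e y) = 0 by move=> xy; rewrite he (negPf xy).
have Ed x : g (e x) (e x) = eps x by rewrite he eqxx.
have df : d != f by rewrite eq_sym.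
have CS' : eps d * C ^+ 2 + eps f * S ^+ 2 = eps d.
  transitivity (eps d * (C ^+ 2 + eps f * eps d * S ^+ 2)
    - eps f * S ^+ 2 * (eps d * eps d - 1)); first by ring.
  by rewrite CS eps2 subrr mulr0 subr0 mulr1.
have CS2 : eps f * C ^+ 2 + eps d * S ^+ 2 = eps f.
  transitivity (eps f * (C ^+ 2 + eps f * eps d * S ^+ 2)
    - eps d * S ^+ 2 * (eps f * eps f - 1)); first by ring.
  by rewrite CS eps2 subrr mulr0 subr0 mulr1.
have out x : x != f -> x != d ->
    forall j, g (e x) (rotate e f d C S j) = eps x *+ (x == j).
  move=> xf xd j; have [/eqP->|jf] := boolP (j == f).
    by rewrite rotate_f gD2 !gZ2 !E// !mulr0 addr0 (negPf xf).
  have [/eqP->|jd] := boolP (j == d).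
    by rewrite rotate_d// gD2 !gZ2 !E// !mulr0 addr0 (negPf xd).
  by rewrite rotate_out// he.
have fdE : g (rotate e f d C S f) (rotate e f d C S d) = 0.
  rewrite rotate_f rotate_d// !(gD, gD2, gZ, gZ2) !Ed (E f d)// (E d f)//.
  transitivity (- (eps d * C * S) * (eps f * eps f - 1)); first by ring.
  by rewrite eps2 subrr mulr0.
have epsC x y : eps x *+ (x == y) = eps y *+ (y == x).
  by case: (eqVneq x y) => [->|].
move=> i j.
have [/andP[xf xd]|ni] := boolP ((i != f) && (i != d)).
  by rewrite [rotate _ _ _ _ _ i]rotate_out// out.
have [/andP[xf xd]|nj] := boolP ((j != f) && (j != d)).
  by rewrite [rotate _ _ _ _ _ j]rotate_out// gC out// epsC.
move: ni nj; rewrite !negb_and !negbK => /orP[/eqP->|/eqP->] /orP[/eqP->|/eqP->].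
- rewrite rotate_f !(gD, gD2, gZ, gZ2) !Ed (E f d)// (E d f)// eqxx mulr1n.
  by rewrite -[RHS]CS2; ring.
- by rewrite fdE (negPf fd).
- by rewrite gC fdE (negPf df).
- rewrite rotate_d// !(gD, gD2, gZ, gZ2) !Ed (E f d)// (E d f)// eqxx mulr1n.
  transitivity (eps f * (eps f * eps f) * (eps d * eps d) * S ^+ 2
    + eps d * C ^+ 2); first by ring.
  by rewrite !eps2 !mulr1 addrC.
Qed.

Lemma eps_sign i : eps i = 1 \/ eps i = -1.
Proof.
have : (eps i - 1) * (eps i + 1) = 0 by have := eps2 i; lra.
by move/eqP; rewrite mulf_eq0 => /orP[/eqP|/eqP] H; [left|right]; lra.
Qed.

(** Rational points on the circle and on the hyperbola. *)
Lemma exists_rotation f d : exists C S,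
  [/\ C ^+ 2 + eps f * eps d * S ^+ 2 = 1, S != 0 & C != 0].
Proof.
have [E|E] : eps f * eps d = 1 \/ eps f * eps d = -1.
- by case: (eps_sign f) => ->; case: (eps_sign d) => ->; [left|right|right|left]; ring.
- by exists (3 / 5), (4 / 5); rewrite E; split; [field|lra|lra].
- by exists (5 / 3), (4 / 3); rewrite E; split; [field|lra|lra].
Qed.

Lemma eps_dichotomy i j f : eps i != eps j -> eps f = eps i \/ eps f = eps j.
Proof.
by case: (eps_sign i) (eps_sign j) (eps_sign f) => -> [] -> [] ->;
  rewrite ?eqxx //; [left|right|right|left].
Qed.

Lemma eps_diff i j : eps i != eps j -> eps i * eps j = -1.
Proof.
by case: (eps_sign i) (eps_sign j) => -> [] ->; rewrite ?eqxx // => _; ring.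
Qed.

End Frames.

(** * Trace free curvature forms vanishing on isotropic planes *)
Ltac split_uniq u :=
  move: u; rewrite /= ?inE ?negb_or -?andbA ?andbT;
  repeat (let h := fresh "n" in case/andP => h); let h := fresh "n" in move=> h.
Ltac neq := solve [assumption | rewrite eq_sym; assumption].
Ltac mk_uniq := rewrite /= ?inE ?negb_or -?andbA ?andbT;
  repeat (apply/andP; split); neq.

Section IsotropicVanishing.
Variables (R : realFieldType) (V : lmodType R) (g : V -> V -> R).
Hypothesis gC : forall x y, g x y = g y x.
Hypothesis gD : forall x y z, g (x + y) z = g x z + g y z.
Hypothesis gZ : forall a x z, g (a *: x) z = a * g x z.
Variables (I : finType) (eps : I -> R).
Hypothesis eps2 : forall i, eps i * eps i = 1.
Variables (c : V -> V -> V -> V -> R) (hc : curvature_form c).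

Local Notation frame := (orthoframe g eps).
Local Notation cE := (cfE hc).

(** With k = x /\ y' + x' /\ y and k' = x /\ y - x' /\ y', these are C(k, k') = 0
    and C(k, k) = C(k', k'), the imaginary and the real part of
    C(z, w, z, w) = 0 for z = x + i x' and w = y + i y'. *)
Definition isotropic (x x' y y' : V) : Prop :=
  c x y' x y - c x y' x' y' + c x' y x y - c x' y x' y' = 0 /\
  c x y' x y' + 2 * c x y' x' y + c x' y x' y
  = c x y x y - 2 * c x y x' y' + c x' y' x' y'.

Hypothesis ricci_flat : forall e, frame e ->
  forall y z, \sum_i eps i * c (e i) y z (e i) = 0.
Hypothesis hiso : forall e, frame e -> forall i i' k k', uniq [:: i; i'; k; k'] ->
  eps i = eps i' -> eps k = eps k' -> isotropic (e i) (e i') (e k) (e k').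
Hypothesis card_ge5 : (5 <= #|I|)%N.

Lemma exists_outside (s : seq I) : (size s <= 4)%N -> exists f, f \notin s.
Proof.
move=> s4; have [f fs|all_in] := pickP [pred x | x \notin s]; first by exists f.
have : (#|I| <= size s)%N.
  rewrite cardE; apply: uniq_leq_size; first exact: enum_uniq.
  by move=> x _; move: (all_in x) => /= /negbFE.
by move=> h; have := leq_trans card_ge5 (leq_trans h s4).
Qed.

(** Changing the sign of the vector of index k' gives a second set of
    identities; sums and differences separate the terms. *)
Lemma isotropic_identities e i i' k k' : frame e -> uniq [:: i; i'; k; k'] ->
  eps i = eps i' -> eps k = eps k' ->
  [/\ c (e i) (e k') (e i) (e k') + c (e i') (e k) (e i') (e k)
      = c (e i) (e k) (e i) (e k) + c (e i') (e k') (e i') (e k'),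
      c (e i) (e k) (e i') (e k') + c (e i) (e k') (e i') (e k) = 0 &
      c (e i) (e k) (e i) (e k') = c (e i') (e k) (e i') (e k')].
Proof.
move=> he u ei ek; have [A B] := hiso he u ei ek.
have [A' B'] := hiso (flip_frame gC gZ k' he) u ei ek.
split_uniq u.
move: A' B'; rewrite flip_f !flip_out; try neq; rewrite !cE => A' B'.
have P1 := cf_pair hc (e i) (e k') (e i) (e k).
have P2 := cf_pair hc (e i') (e k) (e i') (e k').
split; lra.
Qed.

Lemma rotate_in e f d : frame e -> f != d -> exists C S,
  [/\ frame (rotate eps e f d C S), C ^+ 2 + eps f * eps d * S ^+ 2 = 1,
      S != 0 & C != 0].
Proof.
move=> he fd; have [C [S [CS S0 C0]]] := exists_rotation eps2 f d.
by exists C, S; split=> //; exact: rotate_frame.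
Qed.

(** If the vectors of indices k and d have different signs, the identity is
    first known with a fifth vector f, of the sign of one of them, in place of
    the other.  It is linear in that place, so it passes to the frame boosted
    in the plane of f and the vector to be reached.  The other sign conditions
    below are removed by the same boost. *)
Lemma swap_skew_same_sign e i i' k d : frame e -> uniq [:: i; i'; k; d] ->
  eps i = eps i' ->
  c (e i) (e k) (e i') (e d) + c (e i) (e d) (e i') (e k) = 0.
Proof.
have main k0 d0 f e0 : frame e0 -> uniq [:: i; i'; k0; d0; f] ->
    eps i = eps i' -> eps f = eps k0 ->
    c (e0 i) (e0 k0) (e0 i') (e0 d0) + c (e0 i) (e0 d0) (e0 i') (e0 k0) = 0.
  move=> he u ei ef.
  split_uniq u; have u' : uniq [:: i; i'; k0; f] by mk_uniq.
  have [_ H0 _] := isotropic_identities he u' ei (esym ef).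
  have [|C [S [he' _ S0 _]]] := @rotate_in e0 f d0 he; first neq.
  have [_ H1 _] := isotropic_identities he' u' ei (esym ef).
  move: H1; rewrite rotate_f !rotate_out; try neq; rewrite !cE => H1.
  apply: (mulfI S0); rewrite mulr0; rewrite -[RHS]H1.
  by have /(congr1 ( *%R C)) := H0; rewrite mulr0; lra.
move=> he u ei; have [ek|ek] := eqVneq (eps k) (eps d).
  by have [] := isotropic_identities he u ei ek.
have [f fs] := @exists_outside [:: i; i'; k; d] isT.
split_uniq u; split_uniq fs.
have [ef|ef] := eps_dichotomy eps2 f ek.
  by apply: (main _ _ f) => //; mk_uniq.
by rewrite addrC; apply: (main _ _ f) => //; mk_uniq.
Qed.

Lemma swap_skew e i i' k d : frame e -> uniq [:: i; i'; k; d] ->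
  c (e i) (e k) (e i') (e d) + c (e i) (e d) (e i') (e k) = 0.
Proof.
have main i0 i1 f e0 : frame e0 -> uniq [:: i0; i1; k; d; f] ->
    eps f = eps i0 ->
    c (e0 i0) (e0 k) (e0 i1) (e0 d) + c (e0 i0) (e0 d) (e0 i1) (e0 k) = 0.
  move=> he u ef; split_uniq u.
  have u' : uniq [:: i0; f; k; d] by mk_uniq.
  have H0 := swap_skew_same_sign he u' (esym ef).
  have [|C [S [he' _ S0 _]]] := @rotate_in e0 f i1 he; first neq.
  have H1 := swap_skew_same_sign he' u' (esym ef).
  move: H1; rewrite rotate_f !rotate_out; try neq; rewrite !cE => H1.
  apply: (mulfI S0); rewrite mulr0; rewrite -[RHS]H1.
  by have /(congr1 ( *%R C)) := H0; rewrite mulr0; lra.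
move=> he u; have [ei|ei] := eqVneq (eps i) (eps i'); first exact: swap_skew_same_sign.
have [f fs] := @exists_outside [:: i; i'; k; d] isT.
split_uniq u; split_uniq fs.
have [ef|ef] := eps_dichotomy eps2 f ei; first by apply: (main _ _ f) => //; mk_uniq.
rewrite -(cf_pair hc) addrC -(cf_pair hc (e i)).
by apply: (main _ _ f) => //; mk_uniq.
Qed.

(** Antisymmetry under the exchange of two entries turns the Bianchi identity
    into C_ijkl = 2 C_ikjl.  Applied twice, C_ijkl = 4 C_ijkl. *)
Lemma distinct_zero e i j k l : frame e -> uniq [:: i; j; k; l] ->
  c (e i) (e j) (e k) (e l) = 0.
Proof.
move=> he u; split_uniq u.
have h2 i' j' k' l' : uniq [:: i'; j'; k'; l'] ->
    c (e i') (e j') (e k') (e l') = 2 * c (e i') (e k') (e j') (e l').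
  move=> u; split_uniq u; have := cfB hc (e i') (e j') (e k') (e l').
  have := @swap_skew e j' i' k' l' he; rewrite (cf_pair hc (e i') (e k')).
  by rewrite (cf12 hc (e i') (e k')) => H; have := H ltac:(mk_uniq); lra.
have := h2 i j k l ltac:(mk_uniq); have := h2 i k j l ltac:(mk_uniq); lra.
Qed.

(** In the boosted frame the cross terms have four distinct indices and vanish,
    and the quadratic terms differ by the factor C^2 = 1 + S^2. *)
Lemma off_diagonal_const e i i' k k' : frame e -> uniq [:: i; i'; k; k'] ->
  eps k = eps k' ->
  eps i * c (e i) (e k) (e i) (e k') = eps i' * c (e i') (e k) (e i') (e k').
Proof.
have same e0 i0 i1 : frame e0 -> uniq [:: i0; i1; k; k'] -> eps k = eps k' ->
    eps i0 = eps i1 -> c (e0 i0) (e0 k) (e0 i0) (e0 k')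
                     = c (e0 i1) (e0 k) (e0 i1) (e0 k').
  by move=> he u ek ei; have [] := isotropic_identities he u ei ek.
have main e0 i0 i1 f : frame e0 -> uniq [:: i0; i1; k; k'; f] -> eps k = eps k' ->
    eps i0 * eps i1 = -1 -> eps f = eps i0 ->
    c (e0 i0) (e0 k) (e0 i0) (e0 k') = - c (e0 i1) (e0 k) (e0 i1) (e0 k').
  move=> he u ek ei ef; split_uniq u.
  have u' : uniq [:: i0; f; k; k'] by mk_uniq.
  have H0 := same e0 _ _ he u' ek (esym ef).
  have [|C [S [he' CS S0 _]]] := @rotate_in e0 f i1 he; first neq.
  have H1 := same _ _ _ he' u' ek (esym ef).
  have X : c (e0 f) (e0 k) (e0 i1) (e0 k') = 0 by apply: distinct_zero => //; mk_uniq.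
  have Y : c (e0 i1) (e0 k) (e0 f) (e0 k') = 0 by apply: distinct_zero => //; mk_uniq.
  move: H1; rewrite rotate_f !rotate_out; try neq; rewrite !cE X Y -H0 => H1.
  have S20 : S * S != 0 by rewrite mulf_neq0.
  apply: (mulfI S20); rewrite ef ei in CS.
  have CC : C * C = 1 + S * S by rewrite -[1]CS; ring.
  have := congr1 ( *%R^~ (c (e0 i0) (e0 k) (e0 i0) (e0 k'))) CC.
  by rewrite /=; lra.
move=> he u ek; have [ei|ei] := eqVneq (eps i) (eps i').
  by rewrite ei; congr (_ * _); apply: same.
have ep := eps_diff eps2 ei.
have [f fs] := @exists_outside [:: i; i'; k; k'] isT.
split_uniq u; split_uniq fs.
have ee : eps i' = - eps i by case: (eps_sign eps2 i) (eps_sign eps2 i') ep => -> [] ->; lra.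
have [ef|ef] := eps_dichotomy eps2 f ei.
  by rewrite (main e i i' f) // ?ee ?mulrN ?mulNr //; mk_uniq.
rewrite (main e i' i f) //; try mk_uniq; last by rewrite mulrC.
by rewrite ee mulNr mulrN opprK.
Qed.

Lemma sum_const_eq0 (P : pred I) i (a : R) :
  \sum_(j | P j) a = 0 -> P i -> a = 0.
Proof.
rewrite sumr_const => /eqP; rewrite mulrn_eq0 => /orP[|/eqP//] + Pi.
by move/eqP/card0_eq/(_ i); rewrite unfold_in Pi.
Qed.

Lemma eps_scale0 i (a : R) : eps i * a = 0 -> a = 0.
Proof. by case: (eps_sign eps2 i) => ->; lra. Qed.

(** All the terms of the trace are equal by [off_diagonal_const], so the trace
    free condition makes each of them vanish. *)
Lemma off_diagonal_zero_same_sign e i k k' : frame e -> uniq [:: i; k; k'] ->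
  eps k = eps k' -> c (e i) (e k) (e i) (e k') = 0.
Proof.
move=> he u ek; split_uniq u.
have := ricci_flat he (e k) (e k').
have E j : j != k -> j != k' ->
    eps j * c (e j) (e k) (e k') (e j) = - (eps i * c (e i) (e k) (e i) (e k')).
  move=> jk jk'; rewrite (cf34 hc) mulrN; congr (- _).
  have [->//|ji] := eqVneq j i.
  by apply: off_diagonal_const => //; mk_uniq.
rewrite (bigD1 k) //= (bigD1 k') /=; last by neq.
rewrite (cf11 hc) (cf44 hc) !mulr0 !add0r.
rewrite (eq_bigr (fun=> - (eps i * c (e i) (e k) (e i) (e k')))); last first.
  by move=> j /andP[? ?]; apply: E.
have := @sum_const_eq0 (fun j => (j != k) && (j != k')) i.
move=> h /h H; have /eqP := H ltac:(by apply/andP; split; neq).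
by rewrite oppr_eq0 => /eqP /eps_scale0.
Qed.

Lemma off_diagonal_zero e i k k' : frame e -> uniq [:: i; k; k'] ->
  c (e i) (e k) (e i) (e k') = 0.
Proof.
have main k0 k1 f e0 : frame e0 -> uniq [:: i; k0; k1; f] -> eps f = eps k0 ->
    c (e0 i) (e0 k0) (e0 i) (e0 k1) = 0.
  move=> he u ef; split_uniq u.
  have u' : uniq [:: i; k0; f] by mk_uniq.
  have H0 := off_diagonal_zero_same_sign he u' (esym ef).
  have [|C [S [he' _ S0 _]]] := @rotate_in e0 f k1 he; first neq.
  have H1 := off_diagonal_zero_same_sign he' u' (esym ef).
  move: H1; rewrite rotate_f !rotate_out; try neq; rewrite !cE H0 => H1.
  by apply: (mulfI S0); move: H1; lra.
move=> he u; have [ek|ek] := eqVneq (eps k) (eps k').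
  exact: off_diagonal_zero_same_sign.
have [f fs] := @exists_outside [:: i; k; k'] isT.
split_uniq u; split_uniq fs.
have [ef|ef] := eps_dichotomy eps2 f ek; first by apply: (main _ _ f) => //; mk_uniq.
by rewrite -(cf_pair hc); apply: (main _ _ f) => //; mk_uniq.
Qed.

(** A quadratic form without cross term that takes the same value a on a vector
    and on its boost takes the opposite value on the second vector of the
    plane. *)
Lemma hyperbolic_mean (C S a b : R) : C ^+ 2 + - 1 * S ^+ 2 = 1 -> S != 0 ->
  a = C * (C * a) + S * (S * b) -> a = - b.
Proof.
move=> CS S0 E; have S20 : S * S != 0 by rewrite mulf_neq0.
apply: (mulfI S20).
have CC : C * C = 1 + S * S by rewrite -[1]CS; ring.
by have := congr1 ( *%R^~ a) CC; rewrite /=; lra.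
Qed.

Lemma sectional_diff e i i' k k' : frame e -> uniq [:: i; i'; k; k'] ->
  eps i = eps i' ->
  eps k * (c (e i) (e k) (e i) (e k) - c (e i') (e k) (e i') (e k))
  = eps k' * (c (e i) (e k') (e i) (e k') - c (e i') (e k') (e i') (e k')).
Proof.
pose h e0 k0 := c (e0 i) (e0 k0) (e0 i) (e0 k0) - c (e0 i') (e0 k0) (e0 i') (e0 k0).
have same e0 k0 k1 : frame e0 -> uniq [:: i; i'; k0; k1] -> eps i = eps i' ->
    eps k0 = eps k1 -> h e0 k0 = h e0 k1.
  by move=> he u ei ek; have [] := isotropic_identities he u ei ek; rewrite /h; lra.
have main e0 k0 k1 f : frame e0 -> uniq [:: i; i'; k0; k1; f] -> eps i = eps i' ->
    eps k0 * eps k1 = -1 -> eps f = eps k0 -> h e0 k0 = - h e0 k1.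
  move=> he u ei ek ef; split_uniq u.
  have u' : uniq [:: i; i'; k0; f] by mk_uniq.
  have H0 := same e0 _ _ he u' ei (esym ef).
  have [|C [S [he' CS S0 _]]] := @rotate_in e0 f k1 he; first neq.
  have H1 := same _ _ _ he' u' ei (esym ef).
  have X j : j \in [:: i; i'] -> c (e0 j) (e0 f) (e0 j) (e0 k1) = 0.
    by rewrite !inE => /orP[]/eqP->; apply: off_diagonal_zero => //; mk_uniq.
  have Y j : j \in [:: i; i'] -> c (e0 j) (e0 k1) (e0 j) (e0 f) = 0.
    by rewrite !inE => /orP[]/eqP->; apply: off_diagonal_zero => //; mk_uniq.
  rewrite ef ek in CS; apply: (hyperbolic_mean CS S0); rewrite {2}H0.
  move: H1; rewrite /h rotate_f !rotate_out; try neq.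
  rewrite !cE !X ?Y ?inE ?eqxx ?orbT //; lra.
rewrite -!/(h e _) => he u ei; have [ek|ek] := eqVneq (eps k) (eps k').
  by rewrite ek; congr (_ * _); apply: same.
have ep := eps_diff eps2 ek.
have [f fs] := @exists_outside [:: i; i'; k; k'] isT.
split_uniq u; split_uniq fs.
have ee : eps k' = - eps k by case: (eps_sign eps2 k) (eps_sign eps2 k') ep => -> [] ->; lra.
have [ef|ef] := eps_dichotomy eps2 f ek.
  by rewrite (main e k k' f) // ?ee ?mulrN ?mulNr //; mk_uniq.
rewrite (main e k' k f) //; try mk_uniq; last by rewrite mulrC.
by rewrite ee mulNr mulrN opprK.
Qed.

Lemma ricci_diag e i : frame e ->
  \sum_j eps j * c (e i) (e j) (e i) (e j) = 0.
Proof.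
move=> he; transitivity (- \sum_j eps j * c (e j) (e i) (e i) (e j)); last first.
  by rewrite ricci_flat// oppr0.
rewrite -sumrN; apply: eq_bigr => j _; rewrite [in RHS](cf34 hc) mulrN opprK; congr (_ * _).
exact: cf_rev.
Qed.

(** The difference of the Ricci traces at e_i and e_i' is a sum of terms that
    are all equal, by [sectional_diff]; the two terms involving both i and i'
    cancel. *)
Lemma sectional_same e i i' k : frame e -> uniq [:: i; i'; k] ->
  eps i = eps i' -> c (e i) (e k) (e i) (e k) = c (e i') (e k) (e i') (e k).
Proof.
move=> he u ei; split_uniq u; apply/eqP; rewrite -subr_eq0; apply/eqP.
apply: (@eps_scale0 k); set a := _ * _.
apply: (@sum_const_eq0 (fun j => (j != i) && (j != i')) k); last first.
  by apply/andP; split; neq.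
have E := etrans (congr2 (fun x y => x - y) (ricci_diag i he) (ricci_diag i' he))
  (subrr 0).
rewrite -[RHS]E -sumrB [RHS](bigD1 i) //= [in RHS](bigD1 i') /=; last by neq.
rewrite !(cf11 hc) !mulr0 sub0r subr0 addrA (cf_rev hc) ei addNr add0r.
apply: eq_bigr => j /andP[ji ji']; rewrite -mulrBr.
have [->//|jk] := eqVneq j k.
by apply: sectional_diff => //; mk_uniq.
Qed.

Lemma sectional_const e i i' k : frame e -> uniq [:: i; i'; k] ->
  eps i * c (e i) (e k) (e i) (e k) = eps i' * c (e i') (e k) (e i') (e k).
Proof.
have main e0 i0 i1 f : frame e0 -> uniq [:: i0; i1; k; f] ->
    eps i0 * eps i1 = -1 -> eps f = eps i0 ->
    c (e0 i0) (e0 k) (e0 i0) (e0 k) = - c (e0 i1) (e0 k) (e0 i1) (e0 k).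
  move=> he u ei ef; split_uniq u.
  have u' : uniq [:: i0; f; k] by mk_uniq.
  have H0 := sectional_same he u' (esym ef).
  have [|C [S [he' CS S0 _]]] := @rotate_in e0 f i1 he; first neq.
  have H1 := sectional_same he' u' (esym ef).
  have X : c (e0 f) (e0 k) (e0 i1) (e0 k) = 0.
    by rewrite -(cf_rev hc); apply: off_diagonal_zero => //; mk_uniq.
  have Y : c (e0 i1) (e0 k) (e0 f) (e0 k) = 0.
    by rewrite -(cf_rev hc); apply: off_diagonal_zero => //; mk_uniq.
  rewrite ef ei in CS; apply: (hyperbolic_mean CS S0); rewrite {2}H0.
  by move: H1; rewrite rotate_f !rotate_out; try neq; rewrite !cE X Y; lra.
move=> he u; have [ei|ei] := eqVneq (eps i) (eps i').
  by rewrite ei; congr (_ * _); apply: sectional_same.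
have ep := eps_diff eps2 ei.
have [f fs] := @exists_outside [:: i; i'; k] isT.
split_uniq u; split_uniq fs.
have ee : eps i' = - eps i by case: (eps_sign eps2 i) (eps_sign eps2 i') ep => -> [] ->; lra.
have [ef|ef] := eps_dichotomy eps2 f ei.
  by rewrite (main e i i' f) // ?ee ?mulrN ?mulNr //; mk_uniq.
rewrite (main e i' i f) //; try mk_uniq; last by rewrite mulrC.
by rewrite ee mulNr mulrN opprK.
Qed.

Lemma sectional_zero e i k : frame e -> i != k -> c (e i) (e k) (e i) (e k) = 0.
Proof.
move=> he ik; apply: (@eps_scale0 i).
apply: (@sum_const_eq0 (fun j => j != k) i) => //.
rewrite -[RHS](ricci_diag k he) [RHS](bigD1 k) //= (cf11 hc) mulr0 add0r.
apply: eq_bigr => j jk; rewrite [in RHS](cf_rev hc).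
by have [->//|ji] := eqVneq j i; apply: sectional_const => //; mk_uniq.
Qed.

(** Components with four, three and two distinct indices vanish in turn; each
    step supplies the vanishing of the cross terms of the next one. *)
Theorem isotropic_vanishing e i j k l : frame e ->
  c (e i) (e j) (e k) (e l) = 0.
Proof.
move=> he.
have [->|ij] := eqVneq i j; first exact: cf11.
have [->|kl] := eqVneq k l; first exact: cf44.
have R3 a b d : a != b -> a != d -> c (e a) (e b) (e a) (e d) = 0.
  move=> ab ad; have [->|bd] := eqVneq b d; first by apply: sectional_zero; neq.
  by apply: off_diagonal_zero => //; mk_uniq.
have [Ek|ik] := eqVneq k i; first by rewrite Ek in kl *; apply: R3; neq.
have [El|il] := eqVneq l i; first by rewrite (cf34 hc) El R3 ?oppr0 //; neq.
have [Ek|jk] := eqVneq k j.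
  by rewrite Ek in kl *; rewrite (cf12 hc) R3 ?oppr0 //; neq.
have [El|jl] := eqVneq l j.
  by rewrite El in kl *; rewrite -(cf_rev hc) R3 //; neq.
by apply: distinct_zero => //; mk_uniq.
Qed.

End IsotropicVanishing.

(** * The condition in a rotated frame *)
Section PlaneRotation.
Variables (R : realFieldType) (V : lmodType R).
Variables (c : V -> V -> V -> V -> R) (hc : curvature_form c).

(** The reversals that bring each pair of vectors into a fixed order. *)
Lemma cf21 x x' : (forall z w, c x' x z w = - c x x' z w) *
  (forall z w, c z w x' x = - c z w x x').
Proof. by split=> z w; [apply: cf12|apply: cf34]. Qed.

(** Rewrites the value of c on four of the vectors x, x', y, y' into a canonical
    representative of its orbit under the symmetries. *)
Definition cf_canon x x' y y' :=
  (cf11 hc, cf44 hc, cf21 x x', cf21 x y, cf21 x y', cf21 x' y, cf21 x' y',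
   cf21 y y',
   (cf_pair hc x x' x y, cf_pair hc x x' x y', cf_pair hc x x' x' y,
    cf_pair hc x x' x' y', cf_pair hc x x' y y'),
   (cf_pair hc x y x y', cf_pair hc x y x' y, cf_pair hc x y x' y',
    cf_pair hc x y y y'),
   (cf_pair hc x y' x' y, cf_pair hc x y' x' y', cf_pair hc x y' y y'),
   (cf_pair hc x' y x' y', cf_pair hc x' y y y', cf_pair hc x' y' y y')).

Variables (al be : R) (hal : al = 1 \/ al = -1) (hbe : be = 1 \/ be = -1).

(** C(j_U, j_U), C(k, k), C(k', k') and C(k, k') for the bivectors
    j_U = al x /\ x' + be y /\ y', k = x /\ y' + x' /\ y and
    k' = x /\ y - x' /\ y'. *)
Definition cjj x x' y y' :=
  c x x' x x' + 2 * (al * be) * c x x' y y' + c y y' y y'.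
Definition ckk x x' y y' :=
  c x y' x y' + 2 * c x y' x' y + c x' y x' y.
Definition ck2k2 x x' y y' :=
  c x y x y - 2 * c x y x' y' + c x' y' x' y'.
Definition ckk2 x x' y y' :=
  c x y' x y - c x y' x' y' + c x' y x y - c x' y x' y'.

Variable Fr : V -> V -> R.
Hypothesis FrD : forall x y z, Fr (x + y) z = Fr x z + Fr y z.
Hypothesis FrZ : forall a x z, Fr (a *: x) z = a * Fr x z.
Hypothesis FrA : forall x y, Fr y x = - Fr x y.

Lemma FrD2 x y z : Fr z (x + y) = Fr z x + Fr z y.
Proof. by rewrite !(FrA _ z) FrD opprD. Qed.
Lemma FrZ2 a x z : Fr z (a *: x) = a * Fr z x.
Proof. by rewrite !(FrA _ z) FrZ mulrN. Qed.
Lemma Fr0 x : Fr x x = 0.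
Proof. by have := FrA x x; lra. Qed.

(** The condition evaluated on k and on k': j maps x /\ y' to - x' /\ y and
    x /\ y to x' /\ y'.  Fr is the contribution of the planes of j other than
    <x, x'> and <y, y'>. *)
Definition star_on_k x x' y y' :=
  al * c x y' x x' + be * c x y' y y' + Fr x y'
  + (al * c x' y x x' + be * c x' y y y' + Fr x' y) = 0.
Definition star_on_k2 x x' y y' :=
  al * c x y x x' + be * c x y y y' + Fr x y
  - (al * c x' y' x x' + be * c x' y' y y' + Fr x' y') = 0.

Variables (x x' y y' : V).

Definition rotx C S := C *: x + S *: y.
Definition roty C S := (- (al * be * S)) *: x + C *: y.

Lemma rot_wedge C S z w : C ^+ 2 + al * be * S ^+ 2 = 1 ->
  c (rotx C S) (roty C S) z w = c x y z w.
Proof.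
move=> CS; rewrite -[RHS]mul1r -CS /rotx /roty !(cfE hc) !(cf11 hc) (cf12 hc x y).
ring.
Qed.

(** The rotation sends k to C k + S be j_U and the bivector of j to
    j_rest + C j_U - S al k.  The difference of the identities for S and - S
    keeps the terms that are odd in S. *)
Lemma rotated_star_on_k C S : star_on_k (rotx C S) x' (roty C S) y' ->
  star_on_k (rotx C (- S)) x' (roty C (- S)) y' -> S != 0 ->
  be * (al * Fr x x' + be * Fr y y')
  + C * (be * cjj x x' y y' - al * ckk x x' y y') = 0.
Proof.
rewrite /star_on_k /rotx /roty /cjj /ckk !(cfE hc, FrD, FrZ, FrD2, FrZ2) !(cf_canon x x' y y').
rewrite !(FrA x x').
move=> H1 H2 S0; apply: (mulfI S0).
by case: hal H1 H2 => ->; case: hbe => -> H1 H2; lra.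
Qed.

(** The rotation fixes k', so the part of the identity on k' that is odd in S
    is - S al C(k, k'). *)
Lemma rotated_star_on_k2 C S : C ^+ 2 + al * be * S ^+ 2 = 1 ->
  star_on_k2 (rotx C S) x' (roty C S) y' ->
  star_on_k2 (rotx C (- S)) x' (roty C (- S)) y' -> S != 0 ->
  ckk2 x x' y y' = 0.
Proof.
move=> CS; rewrite /star_on_k2 !rot_wedge ?sqrrN //.
have FrE S' : C ^+ 2 + al * be * S' ^+ 2 = 1 -> Fr (rotx C S') (roty C S') = Fr x y.
  move=> CS'; rewrite -[RHS]mul1r -CS' /rotx /roty.
  by rewrite !(FrD, FrZ, FrD2, FrZ2) !Fr0 (FrA x y); ring.
rewrite !FrE ?sqrrN // /ckk2 /rotx /roty !(cfE hc) !(cf_canon x x' y y').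
move=> H1 H2 S0; apply: (mulfI S0).
by case: hal H1 H2 => ->; case: hbe => -> H1 H2; lra.
Qed.

End PlaneRotation.

(** * Half of the bivectors in dimension four *)
Section DimensionFour.
Variables (R : realFieldType) (V : lmodType R).
Variables (c : V -> V -> V -> V -> R) (hc : curvature_form c).
Variables (al be : R) (hal : al = 1 \/ al = -1) (hbe : be = 1 \/ be = -1).

(** The Ricci contraction over the frame x, x', y, y'. *)
Definition four_trace x x' y y' u v := al * c x u v x + al * c x' u v x'
  + be * c y u v y + be * c y' u v y'.

(** Bianchi and the Ricci traces give
    C(k, k) + C(k', k') = - al be C(j_U, j_U), while the hypotheses give
    2 al be C(j_U, j_U) for the same sum, so that C vanishes on the half spanned
    by j_U, k and k'.  The mixed values with the other half are the trace free
    part of the Ricci tensor. *)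
Lemma half_operator_vanishes x x' y y' :
  (forall u v, four_trace x x' y y' u v = 0) ->
  star_on_k c al be (fun _ _ => 0) x x' y y' ->
  star_on_k2 c al be (fun _ _ => 0) x x' y y' ->
  ckk2 c x x' y y' = 0 ->
  ckk c x x' y y' = al * be * cjj c al be x x' y y' ->
  ck2k2 c x x' y y' = ckk c x x' y y' ->
  forall u v, u \in [:: x; x'; y; y'] -> v \in [:: x; x'; y; y'] ->
  [/\ al * c u v x x' + be * c u v y y' = 0,
      c u v x y' + c u v x' y = 0 & c u v x y - c u v x' y' = 0].
Proof.
rewrite /four_trace /star_on_k /star_on_k2 /ckk2 /ckk /ck2k2 /cjj => T s1 s2 e1 e2 e3.
have T1 := T x x; have T2 := T x' x'; have T3 := T y y; have T4 := T y' y'.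
have T5 := T x x'; have T6 := T x y; have T7 := T x y'.
have T8 := T x' y; have T9 := T x' y'; have T10 := T y y'.
have B := cfB hc x x' y y'.
clear T; move: T1 T2 T3 T4 T5 T6 T7 T8 T9 T10 s1 s2 e1 e2 e3 B.
rewrite !(cf_canon hc x x' y y') => T1 T2 T3 T4 T5 T6 T7 T8 T9 T10 s1 s2 e1 e2 e3 B.
pose K u v := [/\ al * c u v x x' + be * c u v y y' = 0,
  c u v x y' + c u v x' y = 0 & c u v x y - c u v x' y' = 0].
have Kdiag u : K u u by rewrite /K !(cf11 hc); split; ring.
have Ksym u v : K u v -> K v u.
  by rewrite /K !(cf12 hc u v) => -[? ? ?]; split; lra.
have K6 : [/\ K x x', K x y, K x y' & [/\ K x' y, K x' y' & K y y']].
  rewrite /K ?(cf_canon hc x x' y y').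
  case: hal T1 T2 T3 T4 T5 T6 T7 T8 T9 T10 s1 s2 e1 e2 e3 B => ->;
  case: hbe => -> T1 T2 T3 T4 T5 T6 T7 T8 T9 T10 s1 s2 e1 e2 e3 B;
  by do !split; lra.
have [k1 k2 k3 [k4 k5 k6]] := K6.
move=> u v; rewrite !inE => /or4P[]/eqP-> /or4P[]/eqP->;
  by [apply: Kdiag|assumption|apply: Ksym].
Qed.

End DimensionFour.

(** * Consequences of the condition for admissible frames *)
Section StarFrames.
Variables (R : realFieldType) (V : lmodType R) (n : nat).
Variables (c : V -> V -> V -> V -> R) (hc : curvature_form c).
Variables (eps : 'I_(n + n) -> R) (eps2 : forall i, eps i * eps i = 1).
Local Notation l := (@lshift n n).
Local Notation r := (@rshift n n).
Hypothesis eps_lr : forall a, eps (r a) = eps (l a).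

(** The curvature operator on the bivector of the complex structure of e. *)
Definition star_form (e : 'I_(n + n) -> V) (X Y : V) : R :=
  \sum_a eps (l a) * c X Y (e (l a)) (e (r a)).

(** The condition on pairs of frame vectors, with j (e (l a)) = e (r a) and
    j (e (r a)) = - e (l a). *)
Definition star_frame (e : 'I_(n + n) -> V) : Prop := forall a b, a != b ->
  star_form e (e (l a)) (e (l b)) = star_form e (e (r a)) (e (r b)) /\
  star_form e (e (l a)) (e (r b)) = - star_form e (e (r a)) (e (l b)).

(** The square of a rotation has positive determinant, so it preserves the
    orientation of a frame; it is the rotation by the doubled angle. *)
Lemma rotate_rotate (e : 'I_(n + n) -> V) f d C S : f != d ->
  rotate eps (rotate eps e f d C S) f d C S
  = rotate eps e f d (C ^+ 2 - eps f * eps d * S ^+ 2) (2 * C * S).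
Proof.
move=> fd; apply/funext => x.
have [->|xf] := eqVneq x f.
  rewrite !rotate_f rotate_d // !scalerDr !scalerA addrACA -!scalerDl.
  by congr (_ *: _ + _ *: _); ring.
have [->|xd] := eqVneq x d.
  rewrite !rotate_d // rotate_f !scalerDr !scalerA addrACA -!scalerDl.
  by congr (_ *: _ + _ *: _); ring.
by rewrite !rotate_out.
Qed.

Variable admissible : ('I_(n + n) -> V) -> Prop.
Hypothesis admissible_rotate : forall e f d C S, admissible e -> f != d ->
  C ^+ 2 + eps f * eps d * S ^+ 2 = 1 ->
  admissible (rotate eps (rotate eps e f d C S) f d C S).
Hypothesis admissible_star : forall e, admissible e -> star_frame e.

(** The doubled angles of the triangles (3, 4, 5) and (4, 3, 5), in the circular
    and in the hyperbolic sense. *)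
Lemma admissible_rotations e f d : admissible e -> f != d -> exists C1 S1 C2 S2,
  [/\ C1 != C2, S1 != 0, S2 != 0 & forall C S,
     (C, S) \in [:: (C1, S1); (C1, - S1); (C2, S2); (C2, - S2)] ->
     C ^+ 2 + eps f * eps d * S ^+ 2 = 1 /\ admissible (rotate eps e f d C S)].
Proof.
move=> ge fd.
have key C0 S0 C S : C0 ^+ 2 + eps f * eps d * S0 ^+ 2 = 1 ->
    C = C0 ^+ 2 - eps f * eps d * S0 ^+ 2 -> S = 2 * C0 * S0 ->
    C ^+ 2 + eps f * eps d * S ^+ 2 = 1 /\ admissible (rotate eps e f d C S).
  move=> E0 -> ->; split; last by rewrite -rotate_rotate //; apply: admissible_rotate.
  transitivity ((C0 ^+ 2 + eps f * eps d * S0 ^+ 2) ^+ 2); first by ring.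
  by rewrite E0 expr1n.
have [E|E] : eps f * eps d = 1 \/ eps f * eps d = -1.
- by case: (eps_sign eps2 f) => ->; case: (eps_sign eps2 d) => ->;
    [left|right|right|left]; ring.
- exists (- 7 / 25), (24 / 25), (7 / 25), (24 / 25); split; try lra.
  move=> C S; rewrite !inE !xpair_eqE; case/or4P => /andP[/eqP-> /eqP->].
  + by apply: (key (3 / 5) (4 / 5)); rewrite ?E; field.
  + by apply: (key (3 / 5) (- 4 / 5)); rewrite ?E; field.
  + by apply: (key (4 / 5) (3 / 5)); rewrite ?E; field.
  + by apply: (key (4 / 5) (- 3 / 5)); rewrite ?E; field.
- exists (41 / 9), (40 / 9), (17 / 8), (15 / 8); split; try lra.
  move=> C S; rewrite !inE !xpair_eqE; case/or4P => /andP[/eqP-> /eqP->].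
  + by apply: (key (5 / 3) (4 / 3)); rewrite ?E; field.
  + by apply: (key (5 / 3) (- 4 / 3)); rewrite ?E; field.
  + by apply: (key (5 / 4) (3 / 4)); rewrite ?E; field.
  + by apply: (key (5 / 4) (- 3 / 4)); rewrite ?E; field.
Qed.

Definition rest e a b X Y : R :=
  \sum_(s | (s != a) && (s != b)) eps (l s) * c X Y (e (l s)) (e (r s)).

Lemma restD e a b x y z : rest e a b (x + y) z = rest e a b x z + rest e a b y z.
Proof.
by rewrite /rest -big_split; apply: eq_bigr => s _ /=; rewrite (cfD hc) mulrDr.
Qed.
Lemma restZ e a b k x z : rest e a b (k *: x) z = k * rest e a b x z.
Proof.
by rewrite /rest mulr_sumr; apply: eq_bigr => s _ /=; rewrite (cfZ hc) mulrCA.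
Qed.
Lemma restA e a b x y : rest e a b y x = - rest e a b x y.
Proof.
by rewrite /rest -sumrN; apply: eq_bigr => s _ /=; rewrite (cf12 hc) mulrN.
Qed.

Lemma star_form_split e a b X Y : a != b ->
  star_form e X Y = eps (l a) * c X Y (e (l a)) (e (r a))
    + eps (l b) * c X Y (e (l b)) (e (r b)) + rest e a b X Y.
Proof.
move=> ab; rewrite /star_form (bigD1 a) //= (bigD1 b) /= ?addrA //.
by rewrite eq_sym.
Qed.

Lemma lr_neq a b : (l a != r b).
Proof. by rewrite eq_lrshift. Qed.
Lemma rl_neq a b : (r a != l b).
Proof. by rewrite eq_rlshift. Qed.
Lemma ll_neq a b : (l a != l b) = (a != b).
Proof. by rewrite eq_lshift. Qed.
Lemma rr_neq a b : (r a != r b) = (a != b).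
Proof. by rewrite eq_rshift. Qed.

Lemma admissible_star_k e a b : admissible e -> a != b ->
  star_on_k c (eps (l a)) (eps (l b)) (rest e a b) (e (l a)) (e (r a)) (e (l b)) (e (r b))
  /\ star_on_k2 c (eps (l a)) (eps (l b)) (rest e a b) (e (l a)) (e (r a)) (e (l b)) (e (r b)).
Proof.
move=> ge ab; have [A B] := admissible_star ge ab.
by move: A B; rewrite /star_on_k /star_on_k2 !(star_form_split _ _ _ ab) => A B; split; lra.
Qed.

Lemma rotated_star_k e a b C S : admissible (rotate eps e (l a) (l b) C S) -> a != b ->
  let x := e (l a) in let y := e (l b) in
  let X := rotx x y C S in let Y := roty (eps (l a)) (eps (l b)) x y C S in
  star_on_k c (eps (l a)) (eps (l b)) (rest e a b) X (e (r a)) Y (e (r b))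
  /\ star_on_k2 c (eps (l a)) (eps (l b)) (rest e a b) X (e (r a)) Y (e (r b)).
Proof.
move=> ge ab /=.
have E X Y : rest (rotate eps e (l a) (l b) C S) a b X Y = rest e a b X Y.
  apply: eq_bigr => s /andP[sa sb].
  by rewrite !rotate_out ?ll_neq // rl_neq.
have := admissible_star_k ge ab; rewrite /star_on_k /star_on_k2 !E.
rewrite rotate_f rotate_d ?ll_neq // !rotate_out ?rl_neq //.
Qed.

(** The identity of [rotated_star_on_k] is affine in C; two values of C separate
    its coefficients. *)
Lemma admissible_diagonal e a b : admissible e -> a != b ->
  ckk2 c (e (l a)) (e (r a)) (e (l b)) (e (r b)) = 0 /\
  ckk c (e (l a)) (e (r a)) (e (l b)) (e (r b)) = eps (l a) * eps (l b) *
    cjj c (eps (l a)) (eps (l b)) (e (l a)) (e (r a)) (e (l b)) (e (r b)).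
Proof.
move=> ge ab; have hal := eps_sign eps2 (l a); have hbe := eps_sign eps2 (l b).
have [|C1 [S1 [C2 [S2 [C12 S10 S20 H]]]]] := @admissible_rotations e (l a) (l b) ge.
  by rewrite ll_neq.
have [E1 g1] := H C1 S1 ltac:(by rewrite !inE eqxx).
have [_ g1'] := H C1 (- S1) ltac:(by rewrite !inE eqxx ?orbT).
have [E2 g2] := H C2 S2 ltac:(by rewrite !inE eqxx ?orbT).
have [_ g2'] := H C2 (- S2) ltac:(by rewrite !inE eqxx ?orbT).
have [s1 t1] := rotated_star_k g1 ab; have [s1' t1'] := rotated_star_k g1' ab.
have [s2 t2] := rotated_star_k g2 ab; have [s2' t2'] := rotated_star_k g2' ab.
split.
  exact: (rotated_star_on_k2 hc hal hbe (@restD e a b) (@restZ e a b) (@restA e a b) E1 t1 t1' S10).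
have k1 := rotated_star_on_k hc hal hbe (@restD e a b) (@restZ e a b) (@restA e a b) s1 s1' S10.
have k2 := rotated_star_on_k hc hal hbe (@restD e a b) (@restZ e a b) (@restA e a b) s2 s2' S20.
have C0 : C1 - C2 != 0 by rewrite subr_eq0.
set J := cjj _ _ _ _ _ _ _ in k1 k2 *; set K := ckk _ _ _ _ _ in k1 k2 *.
have : eps (l b) * J - eps (l a) * K = 0 by apply: (mulfI C0); lra.
by case: hal => ->; case: hbe => ->; lra.
Qed.

(** A rotation in the plane of y and y' fixes j_U and sends k to C k - S k'.
    Since C(k, k) is determined by C(j_U, j_U), it is the same in the rotated
    frame. *)
Lemma admissible_ck2k2 e a b : admissible e -> a != b ->
  ck2k2 c (e (l a)) (e (r a)) (e (l b)) (e (r b))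
  = ckk c (e (l a)) (e (r a)) (e (l b)) (e (r b)).
Proof.
move=> ge ab; have hal := eps_sign eps2 (l a); have hbe := eps_sign eps2 (l b).
have [|C [S [C2 [S2 [_ S0 _ H]]]]] := @admissible_rotations e (l b) (r b) ge.
  by rewrite lr_neq.
have [CS g1] := H C S ltac:(by rewrite !inE eqxx); clear H.
have [k2 k] := admissible_diagonal ge ab; have [_ k'] := admissible_diagonal g1 ab.
move: k'; rewrite rotate_f rotate_d ?lr_neq // !rotate_out ?lr_neq ?rl_neq ?ll_neq ?rr_neq //.
rewrite eps_lr !eps2 mul1r in CS; rewrite eps_lr !eps2 => k'.
set x := e (l a) in k2 k *; set x' := e (r a) in k2 k *.
set y := e (l b) in k2 k *; set y' := e (r b) in k2 k *.
move: k'; rewrite -/x -/x' -/y -/y' mul1r.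
have E1 : cjj c (eps (l a)) (eps (l b)) x x' (C *: y + S *: y') (- S *: y + C *: y')
   = cjj c (eps (l a)) (eps (l b)) x x' y y'.
  have W z w : c z w (C *: y + S *: y') (- S *: y + C *: y') = c z w y y'.
    rewrite -[RHS]mul1r -CS !(cfE hc) !(cf44 hc) (cf34 hc _ _ y y'); ring.
  by rewrite /cjj !W (cf_pair hc y y' (_ + _)) W.
have E2 : ckk c x x' (C *: y + S *: y') (- S *: y + C *: y')
   = C ^+ 2 * ckk c x x' y y' + S ^+ 2 * ck2k2 c x x' y y'
     - 2 * C * S * ckk2 c x x' y y'.
  rewrite /ckk /ck2k2 /ckk2 !(cfE hc) ?(cf_canon hc x x' y y').
  ring.
rewrite E1 -k E2 k2 mulr0 subr0.
have -> : C ^+ 2 = 1 - S ^+ 2 by rewrite -CS; ring.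
have S20 : S ^+ 2 != 0 by rewrite expf_neq0.
by move=> E; apply: (mulfI S20); lra.
Qed.

End StarFrames.

(** * From the condition to the curvature form *)
Section StarVanishing.
Variables (R : realFieldType) (V : lmodType R) (n : nat) (g : V -> V -> R).
Hypothesis gC : forall x y, g x y = g y x.
Hypothesis gD : forall x y z, g (x + y) z = g x z + g y z.
Hypothesis gZ : forall a x z, g (a *: x) z = a * g x z.
Variables (c : V -> V -> V -> V -> R) (hc : curvature_form c).
Variables (eps : 'I_(n + n) -> R) (eps2 : forall i, eps i * eps i = 1).
Local Notation l := (@lshift n n).
Local Notation r := (@rshift n n).
Hypothesis eps_lr : forall a, eps (r a) = eps (l a).
Local Notation frame := (orthoframe g eps).
Hypothesis ricci_flat : forall e, frame e ->
  forall y z, \sum_i eps i * c (e i) y z (e i) = 0.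
Variable admissible : ('I_(n + n) -> V) -> Prop.
Hypothesis admissible_frame : forall e, admissible e -> frame e.
Hypothesis admissible_rotate : forall e f d C S, admissible e -> f != d ->
  C ^+ 2 + eps f * eps d * S ^+ 2 = 1 ->
  admissible (rotate eps (rotate eps e f d C S) f d C S).
Hypothesis admissible_star : forall e, admissible e -> star_frame c eps e.

Lemma admissible_isotropic e a b : admissible e -> a != b ->
  isotropic c (e (l a)) (e (r a)) (e (l b)) (e (r b)).
Proof.
move=> ge ab; have [k2 _] := admissible_diagonal hc eps2 admissible_rotate admissible_star ge ab.
split; first exact: k2.
exact: esym (admissible_ck2k2 hc eps2 eps_lr admissible_rotate admissible_star ge ab).
Qed.

Section HighDimension.
Hypothesis n3 : (3 <= n)%N.
Hypothesis admissible_flip : forall e f, frame e -> admissible e \/ admissible (flip e f).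

(** If e is not admissible, a frame vector outside the four in question is
    reversed, which leaves the identities unchanged. *)
Lemma frame_isotropic e a b : frame e -> a != b ->
  isotropic c (e (l a)) (e (r a)) (e (l b)) (e (r b)).
Proof.
move=> he ab.
have [s] : exists s, s \notin [:: a; b].
  have [s hs|all_in] := pickP [pred x | x \notin [:: a; b]]; first by exists s.
  have : (#|'I_n| <= size [:: a; b])%N.
    rewrite cardE; apply: uniq_leq_size; first exact: enum_uniq.
    by move=> x _; move: (all_in x) => /= /negbFE.
  by rewrite card_ord => h; have := leq_trans n3 h.
rewrite !inE negb_or => /andP[sa sb].
have [ge|ge] := admissible_flip (l s) he; first exact: admissible_isotropic.
have := admissible_isotropic ge ab.
by rewrite !flip_out ?rl_neq ?ll_neq // eq_sym.
Qed.

Definition mate (i : 'I_(n + n)) : 'I_(n + n) :=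
  match fintype.split i with inl a => r a | inr a => l a end.

Lemma mate_l a : mate (l a) = r a.
Proof. by rewrite /mate (unsplitK (inl a)). Qed.
Lemma mate_r a : mate (r a) = l a.
Proof. by rewrite /mate (unsplitK (inr a)). Qed.

Lemma lr_case (P : 'I_(n + n) -> Prop) : (forall a, P (l a)) -> (forall a, P (r a)) ->
  forall i, P i.
Proof.
move=> Pl Pr i; case: (fintype.splitP i) => a E.
  by rewrite (_ : i = l a); last exact: val_inj.
by rewrite (_ : i = r a); last exact: val_inj.
Qed.

Lemma mateK : involutive mate.
Proof. by apply: lr_case => a; rewrite ?mate_l ?mate_r ?mate_l. Qed.

Lemma mate_neq i : mate i != i.
Proof. by move: i; apply: lr_case => a; rewrite ?mate_l ?mate_r ?rl_neq ?lr_neq. Qed.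

Lemma eps_mate i : eps (mate i) = eps i.
Proof. by move: i; apply: lr_case => a; rewrite ?mate_l ?mate_r. Qed.

Lemma perm_frame e (s : {perm 'I_(n + n)}) : (forall i, eps (s i) = eps i) ->
  frame e -> frame (e \o s).
Proof. by move=> hs he i j; rewrite /= he hs (inj_eq perm_inj). Qed.

Lemma tperm_eps i j k : eps i = eps j -> eps (tperm i j k) = eps k.
Proof. by move=> E; case: tpermP => [->|->|]. Qed.

(** Exchanging the two vectors of a plane of j, which have the same sign,
    covers both positions of i and k in their planes. *)
Lemma mates_isotropic e i k : frame e -> k != i -> k != mate i ->
  isotropic c (e i) (e (mate i)) (e k) (e (mate k)).
Proof.
have swap_first e0 a k0 : (forall e, frame e ->
    isotropic c (e (l a)) (e (r a)) (e k0) (e (mate k0))) ->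
    k0 != l a -> k0 != r a -> frame e0 ->
    isotropic c (e0 (r a)) (e0 (l a)) (e0 k0) (e0 (mate k0)).
  move=> H n1 n2 he; have E : eps (l a) = eps (r a) by rewrite eps_lr.
  have := H _ (perm_frame (s := tperm (l a) (r a)) (fun i => tperm_eps i E) he).
  rewrite /= tpermL tpermR !tpermD //; first [by rewrite eq_sym|idtac].
    by apply: contra n2 => /eqP Ek; rewrite -[k0]mateK -Ek mate_l.
  by apply: contra n1 => /eqP Ek; rewrite -[k0]mateK -Ek mate_r.
have first_l e0 a k0 : frame e0 -> k0 != l a -> k0 != r a ->
    isotropic c (e0 (l a)) (e0 (r a)) (e0 k0) (e0 (mate k0)).
  move=> he; move: k0 e0 he; apply: lr_case => b e0 he; rewrite ?mate_l ?mate_r.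
    by rewrite ll_neq eq_sym => ab _; apply: frame_isotropic.
  rewrite rr_neq => _; rewrite eq_sym => ab.
  have E : eps (l b) = eps (r b) by rewrite eps_lr.
  have := frame_isotropic (perm_frame (s := tperm (l b) (r b)) (fun i => tperm_eps i E) he) ab.
  have n1 : l b != l a by rewrite ll_neq eq_sym.
  have n2 : r b != r a by rewrite rr_neq eq_sym.
  by rewrite /= tpermL tpermR !tpermD // ?lr_neq ?rl_neq.
move: i k e; apply: lr_case => a k e he; rewrite ?mate_l ?mate_r => n1 n2.
  exact: first_l.
by apply: swap_first => // e1 he1; apply: first_l.
Qed.

(** Two exchanges of frame vectors of equal sign bring i, i' and k, k' into
    position: the first makes i' the mate of i, and the second makes k' the mate
    of k without moving i and i'. *)
Lemma matched_isotropic e i i' k k' : frame e -> uniq [:: i; i'; k; k'] ->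
  eps i = eps i' -> eps k = eps k' -> isotropic c (e i) (e i') (e k) (e k').
Proof.
move=> he u ei ek; split_uniq u.
set s := tperm (mate i) i'.
have Es j : eps (s j) = eps j by apply: tperm_eps; rewrite eps_mate.
have si : s i = i by rewrite /s tpermD // ?mate_neq //; neq.
have smi : s (mate i) = i' by rewrite tpermL.
have sK j : s (s j) = j by rewrite /s tpermK.
set k1 := s k; set k1' := s k'.
have k1i : k1 != i by rewrite -si (inj_eq perm_inj); neq.
have k1m : k1 != mate i by rewrite -(inj_eq (@perm_inj _ s)) sK smi; neq.
have k1'i : k1' != i by rewrite -si (inj_eq perm_inj); neq.
have k1'm : k1' != mate i by rewrite -(inj_eq (@perm_inj _ s)) sK smi; neq.
have k11 : k1 != k1' by rewrite (inj_eq perm_inj).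
set t := tperm (mate k1) k1'.
have Et j : eps (t j) = eps j by apply: tperm_eps; rewrite eps_mate /k1 /k1' !Es.
have he2 := perm_frame Et (perm_frame Es he).
have := mates_isotropic he2 k1i k1m; rewrite /=.
have ti : t i = i.
  rewrite /t tpermD //.
  by apply: contra k1m => /eqP <-; rewrite mateK.
have tmi : t (mate i) = mate i.
  rewrite /t tpermD //.
  by apply: contra k1i => /eqP/(can_inj mateK) ->.
have tk1 : t k1 = k1 by rewrite /t tpermD // ?mate_neq //; neq.
have tmk : t (mate k1) = k1' by rewrite /t tpermL.
by rewrite ti tmi tk1 tmk si smi /k1 /k1' !sK.
Qed.

Theorem star_vanishing e i j k m : frame e ->
  c (e i) (e j) (e k) (e m) = 0.
Proof.
move=> he; apply: (isotropic_vanishing gC gD gZ eps2 hc ricci_flat) => //.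
  by move=> e0 he0 i0 i1 k0 k1; apply: matched_isotropic.
by rewrite card_ord; apply: (@leq_trans (3 + 3)) => //; apply: leq_add.
Qed.

End HighDimension.

Section LowDimension.
Variables (a b : 'I_n).
Hypothesis ab : a != b.
Hypothesis ab_all : forall s, (s == a) || (s == b).

Lemma rest_zero e X Y : rest c eps e a b X Y = 0.
Proof.
apply: big_pred0 => s; apply/negbTE; rewrite negb_and !negbK; exact: ab_all.
Qed.

Lemma sum_ab (F : 'I_n -> R) : \sum_s F s = F a + F b.
Proof.
rewrite (bigD1 a) //= (bigD1 b) /=; last by rewrite eq_sym.
rewrite big_pred0 ?addr0 // => s; apply/negbTE.
by rewrite negb_and !negbK; exact: ab_all.
Qed.

Lemma star_half e : admissible e -> forall i j,
  [/\ eps (l a) * c (e i) (e j) (e (l a)) (e (r a))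
      + eps (l b) * c (e i) (e j) (e (l b)) (e (r b)) = 0,
      c (e i) (e j) (e (l a)) (e (r b)) + c (e i) (e j) (e (r a)) (e (l b)) = 0 &
      c (e i) (e j) (e (l a)) (e (l b)) - c (e i) (e j) (e (r a)) (e (r b)) = 0].
Proof.
move=> ge i j.
have [k2 kk] := admissible_diagonal hc eps2 admissible_rotate admissible_star ge ab.
have k2k2 := admissible_ck2k2 hc eps2 eps_lr admissible_rotate admissible_star ge ab.
have [s1 s2] := admissible_star_k admissible_star ge ab.
have T u v : four_trace c (eps (l a)) (eps (l b)) (e (l a)) (e (r a)) (e (l b)) (e (r b)) u v = 0.
  rewrite -(ricci_flat (admissible_frame ge) u v) big_split_ord /= !sum_ab /four_trace !eps_lr.
  ring.
have in4 : forall i, e i \in [:: e (l a); e (r a); e (l b); e (r b)].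
  by apply: lr_case => s; have /orP[/eqP->|/eqP->] := ab_all s; rewrite !inE eqxx ?orbT.
apply: (half_operator_vanishes hc (eps_sign eps2 (l a)) (eps_sign eps2 (l b)) T) => //.
  by move: s1; rewrite /star_on_k !rest_zero.
by move: s2; rewrite /star_on_k2 !rest_zero.
Qed.

End LowDimension.

End StarVanishing.

(** * Curvature tensors in components *)
Section TensorForm.
Variables (R : realFieldType) (m : nat).
Implicit Types (T : 'I_m -> 'I_m -> 'I_m -> 'I_m -> R) (X Y Z W : 'cV[R]_m).

Definition mform T X Y Z W : R :=
  \sum_i \sum_j \sum_k \sum_l T i j k l * (X i 0 * Y j 0 * Z k 0 * W l 0).

Record curvature_tensor T : Prop := CurvatureTensor {
  ct12 : forall i j k l, T j i k l = - T i j k l;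
  ct34 : forall i j k l, T i j l k = - T i j k l;
  ctB : forall i j k l, T i j k l + T j k i l + T k i j l = 0 }.

Lemma sum4_eq (F F' : 'I_m -> 'I_m -> 'I_m -> 'I_m -> R) :
  (forall i j k l, F i j k l = F' i j k l) ->
  \sum_i \sum_j \sum_k \sum_l F i j k l = \sum_i \sum_j \sum_k \sum_l F' i j k l.
Proof. by move=> E; do 4 (apply: eq_bigr => ? _). Qed.

Lemma mform_curvature T : curvature_tensor T -> curvature_form (mform T).
Proof.
move=> [T12 T34 TB]; split.
- move=> X X' Y Z W; rewrite /mform -big_split; apply: eq_bigr => i _ /=.
  do 3 (rewrite -big_split; apply: eq_bigr => ? _ /=).
  by rewrite mxE; ring.
- move=> a X Y Z W; rewrite /mform; do 4 (rewrite mulr_sumr; apply: eq_bigr => ? _ /=).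
  by rewrite mxE; ring.
- move=> X Y Z W; rewrite /mform exchange_big -sumrN; apply: eq_bigr => i _ /=.
  do 3 (rewrite -sumrN; apply: eq_bigr => ? _ /=).
  by rewrite T12; ring.
- move=> X Y Z W; rewrite /mform -sumrN; apply: eq_bigr => i _ /=.
  rewrite -sumrN; apply: eq_bigr => j _ /=; rewrite exchange_big /=.
  do 2 (rewrite -sumrN; apply: eq_bigr => ? _ /=).
  by rewrite T34; ring.
move=> X Y Z W; rewrite /mform.
have E1 : \sum_i \sum_j \sum_k \sum_l T i j k l * (Y i 0 * Z j 0 * X k 0 * W l 0)
  = \sum_i \sum_j \sum_k \sum_l T j k i l * (X i 0 * Y j 0 * Z k 0 * W l 0).
  rewrite [RHS]exchange_big; apply: eq_bigr => i _ /=.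
  rewrite [RHS]exchange_big; do 3 (apply: eq_bigr => ? _ /=); congr (_ * _); ring.
have E2 : \sum_i \sum_j \sum_k \sum_l T i j k l * (Z i 0 * X j 0 * Y k 0 * W l 0)
  = \sum_i \sum_j \sum_k \sum_l T k i j l * (X i 0 * Y j 0 * Z k 0 * W l 0).
  rewrite exchange_big; apply: eq_bigr => i _ /=.
  rewrite exchange_big; do 3 (apply: eq_bigr => ? _ /=); congr (_ * _); ring.
rewrite E1 E2 -!big_split /= big1 // => i _; rewrite -!big_split /= big1 // => j _.
rewrite -!big_split /= big1 // => k _; rewrite -!big_split /= big1 // => s _.
by rewrite -!mulrDl TB mul0r.
Qed.

Lemma sum_delta (F : 'I_m -> R) (i : 'I_m) :
  \sum_j F j * (delta_mx i 0 : 'cV[R]_m) j 0 = F i.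
Proof.
rewrite (bigD1 i) //= mxE !eqxx mulr1 big1 ?addr0 // => j ji.
by rewrite mxE (negPf ji) mulr0.
Qed.

Lemma mform_delta T i j k l :
  mform T (delta_mx i 0) (delta_mx j 0) (delta_mx k 0) (delta_mx l 0) = T i j k l.
Proof.
rewrite /mform -[RHS](sum_delta (fun i => T i j k l)); apply: eq_bigr => i' _.
rewrite -(sum_delta (fun j => T i' j k l)) mulr_suml; apply: eq_bigr => j' _.
rewrite -(sum_delta (fun k => T i' j' k l)) !mulr_suml; apply: eq_bigr => k' _.
rewrite -(sum_delta (fun l => T i' j' k' l)) !mulr_suml; apply: eq_bigr => l' _.
ring.
Qed.

Lemma ct_pair T i j k l : curvature_tensor T -> T k l i j = T i j k l.
Proof. by move=> hT; rewrite -!mform_delta (cf_pair (mform_curvature hT)). Qed.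

End TensorForm.

Section Weyl.
Variables (R : realType) (m : nat) (G : 'M[R]_m).
Hypothesis symG : G^T = G.
Variable (Rm : 'I_m -> 'I_m -> 'I_m -> 'I_m -> R).
Hypothesis hR : curvature_tensor Rm.

Lemma sym_entry (A : 'M[R]_m) i j : A^T = A -> A i j = A j i.
Proof. by move=> E; rewrite -{1}E mxE. Qed.

Lemma ricci_sym j k : ricci G Rm j k = ricci G Rm k j.
Proof.
rewrite /ricci [RHS]exchange_big; apply: eq_bigr => i _; apply: eq_bigr => l _ /=.
rewrite (@sym_entry (invmx G)) ?trmx_inv ?symG //; congr (_ * _).
by rewrite -(ct_pair _ _ _ _ hR) (ct12 hR) (ct34 hR) opprK.
Qed.

Lemma schouten_sym j k : schouten G Rm j k = schouten G Rm k j.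
Proof. by rewrite /schouten ricci_sym (@sym_entry G) . Qed.

Lemma weyl_curvature_tensor : curvature_tensor (weyl G Rm).
Proof.
split=> i j k l; rewrite /weyl.
- rewrite (ct12 hR); ring.
- rewrite (ct34 hR); ring.
have P := schouten_sym; have S a b := @sym_entry G a b symG.
rewrite (P k i) (P k j) (P j i) (S k i) (S k j) (S j i).
have := ctB hR i j k l; set A := Rm i j k l; set B := Rm j k i l; set C := Rm k i j l.
by move=> E; rewrite -[RHS]E; ring.
Qed.
End Weyl.

(** * Frames as matrices *)
Section ModelFrames.
Variables (R : realType) (p q : nat).
Local Notation n := (p + q)%N.
Local Notation m := (p + q + (p + q))%N.
Local Notation l := (@lshift (p + q) (p + q)).
Local Notation r := (@rshift (p + q) (p + q)).

Definition eps (i : 'I_m) : R := g0 R p q i i.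

Lemma Ipq_diag a b : Ipq R p q a b = Ipq R p q a a *+ (a == b).
Proof.
have [->|ab] := eqVneq a b; first by rewrite mulr1n.
rewrite mulr0n /Ipq; case: (fintype.splitP a) (fintype.splitP b) => a' Ea [] b' Eb.
- have -> : a = lshift q a' by exact: val_inj.
  have Eb' : b = lshift q b' by exact: val_inj.
  rewrite Eb' block_mxEul mxE; move: ab; rewrite Eb'.
  rewrite (_ : a = lshift q a'); last exact: val_inj.
  by rewrite eq_lshift => /negPf->.
- have -> : a = lshift q a' by exact: val_inj.
  have -> : b = rshift p b' by exact: val_inj.
  by rewrite block_mxEur mxE.
- have -> : a = rshift p a' by exact: val_inj.
  have -> : b = lshift q b' by exact: val_inj.
  by rewrite block_mxEdl mxE.
- have -> : a = rshift p a' by exact: val_inj.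
  have Eb' : b = rshift p b' by exact: val_inj.
  rewrite Eb' block_mxEdr !mxE; move: ab; rewrite Eb'.
  rewrite (_ : a = rshift p a'); last exact: val_inj.
  by rewrite eq_rshift => /negPf->; rewrite oppr0.
Qed.

Lemma Ipq_sign a : Ipq R p q a a * Ipq R p q a a = 1.
Proof.
rewrite /Ipq; case: (fintype.splitP a) => a' Ea.
  have -> : a = lshift q a' by exact: val_inj.
  by rewrite block_mxEul mxE eqxx mulr1.
have -> : a = rshift p a' by exact: val_inj.
by rewrite block_mxEdr !mxE eqxx mulrNN mulr1.
Qed.

Lemma eps_l a : eps (l a) = Ipq R p q a a.
Proof. by rewrite /eps /g0 block_mxEul. Qed.
Lemma eps_r a : eps (r a) = Ipq R p q a a.
Proof. by rewrite /eps /g0 block_mxEdr. Qed.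
Lemma eps_lr a : eps (r a) = eps (l a).
Proof. by rewrite eps_l eps_r. Qed.

Lemma eps2 i : eps i * eps i = 1.
Proof. by move: i; apply: lr_case => a; rewrite ?eps_l ?eps_r Ipq_sign. Qed.

Lemma g0_diag i j : g0 R p q i j = eps i *+ (i == j).
Proof.
move: i j; apply: lr_case => a; apply: lr_case => b; rewrite ?eps_l ?eps_r /g0.
- by rewrite block_mxEul Ipq_diag eq_lshift.
- by rewrite block_mxEur mxE eq_lrshift mulr0n.
- by rewrite block_mxEdl mxE eq_rlshift mulr0n.
- by rewrite block_mxEdr Ipq_diag eq_rshift.
Qed.

Lemma g0_mul k (A : 'M[R]_(m, k)) i j : (g0 R p q *m A) i j = eps i * A i j.
Proof.
rewrite mxE (bigD1 i) //= g0_diag eqxx mulr1n big1 ?addr0 // => s si.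
by rewrite g0_diag eq_sym (negPf si) mul0r.
Qed.

Lemma mul_g0 k (A : 'M[R]_(k, m)) i j : (A *m g0 R p q) i j = A i j * eps j.
Proof.
rewrite mxE (bigD1 j) //= g0_diag eqxx mulr1n big1 ?addr0 // => s sj.
by rewrite g0_diag (negPf sj) mulr0.
Qed.

Lemma g0_sqr : g0 R p q *m g0 R p q = 1%:M.
Proof.
apply/matrixP => i j; rewrite g0_mul g0_diag mxE.
by have [_|_] := eqVneq i j; rewrite ?mulr1n ?eps2 // mulr0.
Qed.

Lemma j0_delta a :
  j0 R p q *m delta_mx (l a) 0 = delta_mx (r a) 0 :> 'cV_m /\
  j0 R p q *m delta_mx (r a) 0 = - delta_mx (l a) 0 :> 'cV_m.
Proof.
by split; apply/matrixP => i k; rewrite ord1 -colE mxE; move: i; apply: lr_case => b;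
  rewrite /j0 ?block_mxEul ?block_mxEur ?block_mxEdl ?block_mxEdr !mxE
    ?eqxx ?andbT ?eq_lrshift ?eq_rlshift ?eq_lshift ?eq_rshift ?oppr0.
Qed.

Lemma pi1_sqr (xi : 'M[R]_m) : xi \in unitmx -> pi1 xi *m pi1 xi = - 1%:M.
Proof.
move=> u; have j2 : j0 R p q *m j0 R p q = - 1%:M.
  rewrite /j0 mulmx_block !(mul0mx, mulmx0, mulNmx, mulmxN, mul1mx) !(add0r, addr0).
  by rewrite [in RHS]scalar_mx_block opp_block_mx oppr0.
rewrite /pi1 -!mulmxA mulKmx // (mulmxA (j0 R p q)) j2.
by rewrite mulNmx mul1mx mulmxN mulmxV.
Qed.

Variable G : 'M[R]_m.
Hypothesis symG : G^T = G.

Definition gform (X Y : 'cV[R]_m) : R := (X^T *m G *m Y) 0 0.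

Lemma gformC X Y : gform X Y = gform Y X.
Proof.
rewrite /gform -[in LHS](trmxK (X^T *m G *m Y)) mxE !trmx_mul symG trmxK.
by rewrite mulmxA.
Qed.
Lemma gformD X Y Z : gform (X + Y) Z = gform X Z + gform Y Z.
Proof. by rewrite /gform linearD /= !mulmxDl mxE. Qed.
Lemma gformZ a X Z : gform (a *: X) Z = a * gform X Z.
Proof. by rewrite /gform linearZ /= -!scalemxAl mxE. Qed.

Definition frame_mx (e : 'I_m -> 'cV[R]_m) : 'M[R]_m := \matrix_(i, k) e k i 0.

Lemma frame_mx_delta e k : frame_mx e *m delta_mx k 0 = e k.
Proof. by apply/matrixP => i j; rewrite ord1 -colE !mxE. Qed.

Lemma col_frame_mx (xi : 'M[R]_m) : frame_mx (fun k => col k xi) = xi.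
Proof. by apply/matrixP => i j; rewrite !mxE. Qed.

Lemma delta_entry (A : 'M[R]_m) i j :
  A i j = ((delta_mx i 0 : 'cV_m)^T *m A *m (delta_mx j 0 : 'cV_m)) 0 0.
Proof. by rewrite trmx_delta -rowE -colE !mxE. Qed.

Lemma frame_gram e i j : ((frame_mx e)^T *m G *m frame_mx e) i j = gform (e i) (e j).
Proof.
rewrite /gform -!frame_mx_delta trmx_mul (delta_entry (_ *m frame_mx e)).
by rewrite !mulmxA.
Qed.

Lemma orthoframeP e :
  orthoframe gform eps e <-> (frame_mx e)^T *m G *m frame_mx e = g0 R p q.
Proof.
split=> [he|E i j]; last by rewrite -frame_gram E g0_diag.
by apply/matrixP => i j; rewrite frame_gram he g0_diag.
Qed.

Section OneFrame.
Variable e : 'I_m -> 'cV[R]_m.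
Hypothesis he : orthoframe gform eps e.
Let xi := frame_mx e.

Lemma frame_left : (xi *m g0 R p q *m xi^T) *m G = 1%:M.
Proof.
have E := (orthoframeP e).1 he; rewrite -/xi in E.
have : (g0 R p q *m xi^T *m G) *m xi = 1%:M.
  by rewrite -[_ *m xi^T *m G]mulmxA -[LHS]mulmxA E g0_sqr.
by move/mulmx1C; rewrite !mulmxA.
Qed.

Lemma unit_metric : G \in unitmx.
Proof. by case: (mulmx1_unit frame_left). Qed.

Lemma unit_frame : xi \in unitmx.
Proof. by move: frame_left; rewrite -!mulmxA => /mulmx1_unit []. Qed.

Lemma inv_metric : invmx G = xi *m g0 R p q *m xi^T.
Proof.
by rewrite -[LHS]mul1mx -frame_left mulmxK // unit_metric.
Qed.

(** The Gram matrix relation says that the transpose of xi is, up to the metrics,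
    the inverse of xi. *)
Lemma inv_frame : invmx xi = g0 R p q *m xi^T *m G.
Proof.
have : xi *m (g0 R p q *m xi^T *m G) = 1%:M by rewrite !mulmxA frame_left.
by move=> E; rewrite -[RHS](mulKmx unit_frame) E mulmx1.
Qed.

Lemma inv_metric_entry i k : invmx G i k = \sum_a eps a * (e a i 0 * e a k 0).
Proof.
rewrite inv_metric mxE; apply: eq_bigr => a _.
by rewrite mul_g0 !mxE; ring.
Qed.

Lemma frame_expand X : X = \sum_i (eps i * gform (e i) X) *: e i.
Proof.
transitivity (xi *m (g0 R p q *m (xi^T *m (G *m X)))).
  by rewrite !mulmxA frame_left mul1mx.
apply/matrixP => i j; rewrite ord1 mxE summxE; apply: eq_bigr => k _.
rewrite mxE [in RHS]mxE mulrC g0_mul; congr (_ * _ * _).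
rewrite /gform -frame_mx_delta trmx_mul trmx_delta.
by rewrite -!mulmxA -rowE [RHS]mxE.
Qed.

Lemma frame_linear_zero (K : 'cV[R]_m -> R) :
  (forall X Y, K (X + Y) = K X + K Y) -> (forall a X, K (a *: X) = a * K X) ->
  (forall i, K (e i) = 0) -> forall X, K X = 0.
Proof.
move=> KD KZ K0 X; rewrite (frame_expand X).
have K00 : K 0 = 0 by rewrite -(scale0r 0) KZ mul0r.
elim/big_rec: _ => // i Y _ E; by rewrite KD KZ K0 E mulr0 addr0.
Qed.

End OneFrame.

Variables (T : 'I_m -> 'I_m -> 'I_m -> 'I_m -> R).
Hypothesis hT : curvature_tensor T.
Hypothesis T0 : forall j k, \sum_i \sum_l invmx G i l * T i j k l = 0.

(** The frame expresses the inverse metric as the sum of the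
    eps_a e_a e_a^T, so the trace can be taken over the frame. *)
Lemma mform_ricci_flat e : orthoframe gform eps e ->
  forall Y Z, \sum_i eps i * mform T (e i) Y Z (e i) = 0.
Proof.
move=> he Y Z.
transitivity (\sum_j \sum_k (Y j 0 * Z k 0) *
  (\sum_i \sum_l invmx G i l * T i j k l)); last first.
  by rewrite big1 // => j _; rewrite big1 // => k _; rewrite T0 mulr0.
rewrite /mform.
transitivity (\sum_i \sum_j \sum_k \sum_l
  invmx G i l * T i j k l * (Y j 0 * Z k 0)); last first.
  rewrite exchange_big; apply: eq_bigr => j _; rewrite exchange_big; apply: eq_bigr => k _ /=.
  rewrite mulr_sumr; apply: eq_bigr => i _; rewrite mulr_sumr; apply: eq_bigr => s _.
  by rewrite mulrC.
under eq_bigr do rewrite mulr_sumr.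
rewrite exchange_big; apply: eq_bigr => i _ /=.
under eq_bigr do rewrite mulr_sumr.
rewrite exchange_big; apply: eq_bigr => j _ /=.
under eq_bigr do rewrite mulr_sumr.
rewrite exchange_big; apply: eq_bigr => k _ /=.
under eq_bigr do rewrite mulr_sumr.
rewrite exchange_big; apply: eq_bigr => s _ /=.
rewrite (inv_metric_entry he) !mulr_suml; apply: eq_bigr => a _.
ring.
Qed.

End ModelFrames.

(** * The condition at a point *)
Section PointwiseStar.
Variables (R : realType) (p q : nat).
Local Notation n := (p + q)%N.
Local Notation m := (p + q + (p + q))%N.
Local Notation l := (@lshift (p + q) (p + q)).
Local Notation r := (@rshift (p + q) (p + q)).
Local Notation eps := (eps R (p := p) (q := q)).
Variable G : 'M[R]_m.
Hypothesis symG : G^T = G.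
Local Notation gform := (gform (p := p) (q := q)).
Local Notation frame_mx := (frame_mx (p := p) (q := q)).
Local Notation frame := (orthoframe (gform G) eps).

(** s is the orientation of the coordinate basis, if there is one. *)
Definition admissible (s : option R) (e : 'I_m -> 'cV[R]_m) : Prop :=
  frame e /\ (if s is Some s' then 0 < s' * \det (frame_mx e) else True).

Lemma frame_mx_mul (M : 'M[R]_m) (v : 'I_m -> 'cV[R]_m) :
  frame_mx (fun k => M *m v k) = M *m frame_mx v.
Proof. by apply/matrixP => i j; rewrite !mxE; apply: eq_bigr => k _; rewrite mxE. Qed.

Lemma frame_mx_rotate e f d C S :
  frame_mx (rotate eps e f d C S)
  = frame_mx e *m frame_mx (rotate eps (fun i => delta_mx i 0) f d C S).
Proof.
rewrite -frame_mx_mul; congr frame_mx; apply/funext => k; rewrite /rotate.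
by case: ifP => _; [|case: ifP => _];
  rewrite ?mulmxDr -?scalemxAr !frame_mx_delta.
Qed.

Lemma admissible_rotate s e f d C S : admissible s e -> f != d ->
  C ^+ 2 + eps f * eps d * S ^+ 2 = 1 ->
  admissible s (rotate eps (rotate eps e f d C S) f d C S).
Proof.
move=> [he hs] fd CS.
have rf := rotate_frame (gformC symG) (gformD G) (gformZ G) (@eps2 R p q) fd CS.
have he2 := rf _ (rf _ he); split=> //.
set A := frame_mx (rotate eps (fun i => delta_mx i 0) f d C S).
have E : frame_mx (rotate eps (rotate eps e f d C S) f d C S)
    = frame_mx e *m A *m A.
  by rewrite frame_mx_rotate (frame_mx_rotate e).
case: s hs => [s|//] hs; rewrite E !det_mulmx -mulrA -expr2 mulrA.
rewrite pmulr_rgt0 // lt_def sqr_ge0 andbT sqrf_eq0.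
have := unit_frame he2; rewrite E unitmx_mul => /andP[_].
by rewrite unitmxE unitfE.
Qed.

Lemma det_frame_mx_flip (e : 'I_m -> 'cV[R]_m) f : \det (frame_mx (flip e f)) = - \det (frame_mx e).
Proof.
have -> : frame_mx (flip e f)
    = frame_mx e *m diag_mx (\row_k (if k == f then -1 else 1)).
  apply/matrixP => i k; rewrite mul_mx_diag !mxE /flip.
  by have [->|_] := eqVneq k f; rewrite ?mxE ?mulr1 // mulrN1 mulN1r.
rewrite det_mulmx det_diag (bigD1 f) //= mxE eqxx big1 ?mulr1 ?mulrN1 //.
by move=> k kf; rewrite mxE (negPf kf).
Qed.

Lemma admissible_flip (s : option R) e f : (if s is Some s' then s' != 0 : Prop else True) ->
  frame e -> admissible s e \/ admissible s (flip e f).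
Proof.
move=> hs he; have hf := flip_frame (gformC symG) (gformZ G) f he.
case: s hs => [s s0|_]; last by left.
have d0 : s * \det (frame_mx e) != 0.
  by rewrite mulf_neq0 // -unitfE -unitmxE; apply: unit_frame he.
have [h|h|/esym/eqP] := ltgtP 0 (s * \det (frame_mx e)); first by left.
  by right; split=> //; rewrite det_frame_mx_flip mulrN oppr_gt0.
by rewrite (negPf d0).
Qed.

Section AtFrame.
Variable e : 'I_m -> 'cV[R]_m.
Hypothesis he : frame e.
Let J : 'M[R]_m := pi1 (frame_mx e).

Lemma J_l a : J *m e (l a) = e (r a).
Proof.
rewrite -[e (l a)]frame_mx_delta /J /pi1 -!mulmxA mulKmx ?(unit_frame he) //.
by rewrite (j0_delta _ a).1 frame_mx_delta.
Qed.

Lemma J_r a : J *m e (r a) = - e (l a).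
Proof.
rewrite -[e (r a)]frame_mx_delta /J /pi1 -!mulmxA mulKmx ?(unit_frame he) //.
by rewrite (j0_delta _ a).2 mulmxN frame_mx_delta.
Qed.

Lemma J_sum X : J *m X = \sum_a eps (l a) *:
  (gform G X (e (l a)) *: e (r a) - gform G X (e (r a)) *: e (l a)).
Proof.
rewrite [in LHS](frame_expand he X) mulmx_sumr big_split_ord /= -big_split /=.
apply: eq_bigr => a _; rewrite -!scalemxAr J_l J_r eps_lr.
by rewrite scalerBr !scalerA scalerN !(gformC symG _ X).
Qed.

Lemma J_sqr (X : 'cV[R]_m) : J *m (J *m X) = - X.
Proof.
by rewrite /J mulmxA (pi1_sqr (unit_frame he)) mulNmx mul1mx.
Qed.

(** The trace is computed in the frame: its a-th term pairs e_a with K j e_a. *)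
Lemma trace_J (K : 'M[R]_m) :
  \tr (K *m J) = \sum_a eps (l a) * (gform G (e (l a)) (K *m e (r a))
                                   - gform G (e (r a)) (K *m e (l a))).
Proof.
have -> : \tr (K *m J) = \tr (invmx (frame_mx e) *m (K *m (J *m frame_mx e))).
  by rewrite [RHS]mxtrace_mulC (mulmxA K) mulmxK ?(unit_frame he).
transitivity (\sum_k eps k * gform G (e k) (K *m (J *m e k))).
  apply: eq_bigr => k _; rewrite (inv_frame he) -!mulmxA g0_mul; congr (_ * _).
  rewrite /gform -!(frame_mx_delta e k) trmx_mul trmx_delta.
  by rewrite -!mulmxA -rowE [RHS]mxE !mulmxA -colE [RHS]mxE.
rewrite big_split_ord /= -big_split /=; apply: eq_bigr => a _.
rewrite J_l J_r eps_lr mulmxN -mulrDr; congr (_ * (_ + _)).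
by rewrite /gform mulmxN mxE.
Qed.

End AtFrame.

Lemma gformE (A : 'M[R]_m) (X Y : 'cV[R]_m) : gform A X Y = \sum_i \sum_j A i j * (X i 0 * Y j 0).
Proof.
rewrite /gform mxE exchange_big; apply: eq_bigr => j _ /=.
by rewrite mxE mulr_suml; apply: eq_bigr => i _; rewrite mxE; ring.
Qed.

(** The Kulkarni-Nomizu product of the metric with P. *)
Definition kulkarni (P : 'M[R]_m) (X Y Z W : 'cV[R]_m) : R :=
  gform P X W * gform G Y Z + gform G X W * gform P Y Z
  - gform P X Z * gform G Y W - gform G X Z * gform P Y W.

Lemma mform_add (T T' : 'I_m -> 'I_m -> 'I_m -> 'I_m -> R) (X Y Z W : 'cV[R]_m) :
  mform (fun i j k l => T i j k l + T' i j k l) X Y Z W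
  = mform T X Y Z W + mform T' X Y Z W :> R.
Proof.
rewrite /mform; do 4 (rewrite -big_split; apply: eq_bigr => ? _ /=).
by rewrite mulrDl.
Qed.

Lemma mform_opp (T : 'I_m -> 'I_m -> 'I_m -> 'I_m -> R) (X Y Z W : 'cV[R]_m) :
  mform (fun i j k l => - T i j k l) X Y Z W = - mform T X Y Z W :> R.
Proof.
rewrite /mform; do 4 (rewrite -sumrN; apply: eq_bigr => ? _ /=).
by rewrite mulNr.
Qed.

Lemma mform_il_jk (A B : 'M[R]_m) (X Y Z W : 'cV[R]_m) :
  mform (fun i j k l => A i l * B j k) X Y Z W = gform A X W * gform B Y Z.
Proof.
rewrite !gformE /mform mulr_suml; apply: eq_bigr => i _.
rewrite mulr_sumr; apply: eq_bigr => j _; rewrite mulr_sumr; apply: eq_bigr => k _.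
by rewrite !mulr_suml; apply: eq_bigr => s _; ring.
Qed.

Lemma mform_ik_jl (A B : 'M[R]_m) (X Y Z W : 'cV[R]_m) :
  mform (fun i j k l => A i k * B j l) X Y Z W = gform A X Z * gform B Y W.
Proof.
rewrite -mform_il_jk /mform; apply: eq_bigr => i _; apply: eq_bigr => j _.
rewrite exchange_big; apply: eq_bigr => k _; apply: eq_bigr => s _ /=; ring.
Qed.

Variable Rm : 'I_m -> 'I_m -> 'I_m -> 'I_m -> R.
Hypothesis hR : curvature_tensor Rm.
Let P : 'M[R]_m := \matrix_(i, j) schouten G Rm i j.
Let W := mform (weyl G Rm).

Lemma mform_weyl X Y Z Z' : mform Rm X Y Z Z' = W X Y Z Z' + kulkarni P X Y Z Z'.
Proof.
rewrite /W /kulkarni -(mform_il_jk P G X Y Z Z') -(mform_il_jk G P X Y Z Z').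
rewrite -(mform_ik_jl P G X Y Z Z') -(mform_ik_jl G P X Y Z Z').
rewrite -!mform_opp -!mform_add.
by apply: sum4_eq => i j k s; rewrite /weyl !mxE; ring.
Qed.

(** Expanding jX and jY in the frame ([J_sum]) recognises the sum over the
    frame. *)
Lemma star_form_kulkarni e X Y : frame e ->
  \sum_a eps (l a) * kulkarni P X Y (e (l a)) (e (r a))
  = gform P X (pi1 (frame_mx e) *m Y) - gform P Y (pi1 (frame_mx e) *m X).
Proof.
have PE A B (F : 'I_n -> 'cV[R]_m) : gform A B (\sum_a F a) = \sum_a gform A B (F a).
  by rewrite /gform mulmx_sumr summxE.
have PZ A B a F : gform A B (a *: F) = a * gform A B F by rewrite /gform -scalemxAr mxE.
have PB A B F F' : gform A B (F - F') = gform A B F - gform A B F'.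
  by rewrite /gform mulmxBr !mxE.
move=> he; rewrite !(J_sum he) !PE -sumrB; apply: eq_bigr => a _.
rewrite !PZ !PB !PZ /kulkarni; ring.
Qed.

Variable K : 'cV[R]_m -> 'cV[R]_m -> 'M[R]_m.
Hypothesis hK : forall X Y Z Z', gform G Z' (K X Y *m Z) = mform Rm X Y Z Z'.

Lemma trace_star_form e X Y : frame e ->
  \tr (K X Y *m pi1 (frame_mx e)) = -2 * star_form (mform Rm) eps e X Y.
Proof.
move=> he; rewrite trace_J // /star_form mulr_sumr; apply: eq_bigr => a _.
by rewrite !hK (cf34 (mform_curvature hR) _ _ (e (l a))); ring.
Qed.

Definition star_at e := forall X Y : 'cV[R]_m,
  let j := pi1 (frame_mx e) in
  \tr (K (j *m X) (j *m Y) *m j) = \tr (K X Y *m j).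

(** P(X, jY) - P(Y, jX) is unchanged when X, Y become jX, jY, because j^2 = -1
    and P is symmetric; so the Schouten part drops out of the condition. *)
Lemma star_at_weyl e : frame e -> star_at e <->
  forall X Y, let j := pi1 (frame_mx e) in
    star_form W eps e (j *m X) (j *m Y) = star_form W eps e X Y.
Proof.
move=> he; have symP : P^T = P.
  by apply/matrixP => i j; rewrite !mxE schouten_sym.
have E X Y : star_form (mform Rm) eps e X Y = star_form W eps e X Y
    + \sum_a eps (l a) * kulkarni P X Y (e (l a)) (e (r a)).
  by rewrite /star_form -big_split; apply: eq_bigr => a _; rewrite mform_weyl mulrDr.
have I X Y : star_form (mform Rm) eps e (pi1 (frame_mx e) *m X) (pi1 (frame_mx e) *m Y)
   - star_form (mform Rm) eps e X Y =
   star_form W eps e (pi1 (frame_mx e) *m X) (pi1 (frame_mx e) *m Y)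
   - star_form W eps e X Y.
  rewrite !E !star_form_kulkarni // !J_sqr //.
  have N A B : gform P A (- B) = - gform P A B by rewrite /gform mulmxN mxE.
  rewrite !N (gformC symP Y (_ *m X)) (gformC symP (_ *m Y) X); ring.
split=> H X Y /=; have := H X Y; have := I X Y => /=; rewrite !trace_star_form //; lra.
Qed.

Lemma star_at_frame e : frame e -> star_at e -> star_frame W eps e.
Proof.
move=> he /(star_at_weyl he) H a b _.
have h1 := H (e (l a)) (e (l b)); have h2 := H (e (l a)) (e (r b)).
move: h1 h2; rewrite /= !J_l // !J_r // => h1 h2; split; first by [].
rewrite -h2 /star_form -sumrN; apply: eq_bigr => s _.
have := cfZ2 (mform_curvature (weyl_curvature_tensor symG hR)) (-1).
by rewrite /W => hZ; rewrite -scaleN1r hZ; ring.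
Qed.

Lemma star_form_zero_at e : frame e ->
  (forall X Y, star_form W eps e X Y = 0) -> star_at e.
Proof. by move=> he H; apply/(star_at_weyl he) => X Y /=; rewrite !H. Qed.

End PointwiseStar.

(** * Vanishing of the Weyl tensor at a point *)
Section PointwiseWeyl.
Variables (R : realType) (p q : nat).
Local Notation n := (p + q)%N.
Local Notation m := (p + q + (p + q))%N.
Local Notation l := (@lshift (p + q) (p + q)).
Local Notation r := (@rshift (p + q) (p + q)).
Local Notation eps := (eps R (p := p) (q := q)).
Local Notation gform := (gform (p := p) (q := q)).
Local Notation frame_mx := (frame_mx (p := p) (q := q)).
Variables (G : 'M[R]_m) (symG : G^T = G).
Local Notation frame := (orthoframe (gform G) eps).
Variable Rm : 'I_m -> 'I_m -> 'I_m -> 'I_m -> R.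
Hypothesis hR : curvature_tensor Rm.
Variable K : 'cV[R]_m -> 'cV[R]_m -> 'M[R]_m.
Hypothesis hK : forall X Y Z Z', gform G Z' (K X Y *m Z) = mform Rm X Y Z Z'.
Variable e0 : 'I_m -> 'cV[R]_m.
Hypothesis he0 : frame e0.
Hypothesis n2 : (2 <= n)%N.
Local Notation C := (weyl G Rm).
Local Notation W := (mform (weyl G Rm)).

Definition sign_option (s : option R) : Prop := if s is Some s' then s' != 0 : Prop else True.

Let hW : curvature_form W := mform_curvature (weyl_curvature_tensor symG hR).

Lemma weyl_ricci_flat e : frame e ->
  forall Y Z, \sum_i eps i * W (e i) Y Z (e i) = 0.
Proof.
apply: mform_ricci_flat => j k; apply: weyl_trace_free => //.
  by apply: (@leq_trans (2 + 2)) => //; apply: leq_add.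
exact: unit_metric he0.
Qed.

Lemma weyl_zero_star e : frame e -> (forall i j k h, C i j k h = 0) ->
  star_at K e.
Proof.
move=> he C0; apply: (star_form_zero_at symG hR hK) => // X Y.
apply: big1 => a _; rewrite /mform big1 ?mulr0 // => i _.
by do 3 (apply: big1 => ? _); rewrite C0 mul0r.
Qed.

Lemma mform_frame_zero (e : 'I_m -> 'cV[R]_m) : frame e ->
  (forall X Y i j, W X Y (e i) (e j) = 0) -> forall i j k h, C i j k h = 0.
Proof.
move=> he H i j k h; rewrite -mform_delta.
apply: (frame_linear_zero (K := W _ _ _) he).
- by move=> X Y; exact: (cfD4 hW).
- by move=> a X; exact: (cfZ4 hW).
move=> h'; apply: (frame_linear_zero (K := fun Z => W _ _ Z _) he).
- by move=> X Y; exact: (cfD3 hW).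
- by move=> a X; exact: (cfZ3 hW).
move=> k'; exact: H.
Qed.

Lemma frame_linear_zero2 (e : 'I_m -> 'cV[R]_m) (F : 'cV[R]_m -> 'cV[R]_m -> R) : frame e ->
  (forall X X' Y, F (X + X') Y = F X Y + F X' Y) ->
  (forall a X Y, F (a *: X) Y = a * F X Y) ->
  (forall X Y, F Y X = - F X Y) ->
  (forall i j, F (e i) (e j) = 0) -> forall X Y, F X Y = 0.
Proof.
move=> he FD FZ FA F0 X Y.
apply: (frame_linear_zero (K := fun X => F X Y) he) => // i.
apply: (frame_linear_zero (K := fun Y => F (e i) Y) he) => //.
- by move=> Z Z'; rewrite !(FA _ (e i)) FD opprD.
- by move=> a Z; rewrite !(FA _ (e i)) FZ mulrN.
Qed.

Section FromStar.
Variable s : option R.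
Hypothesis hs : sign_option s.
Hypothesis hstar : forall e, admissible G s e -> star_at K e.

Let admissible_star_frame e : admissible G s e -> star_frame W eps e.
Proof. by move=> ge; apply: (star_at_frame symG hR hK); [case: ge|exact: hstar]. Qed.

Theorem star_weyl_zero_high : (3 <= n)%N -> forall i j k h, C i j k h = 0.
Proof.
move=> n3; apply: (mform_frame_zero he0) => X Y i j.
apply: (@frame_linear_zero2 e0 (fun X Y => W X Y (e0 i) (e0 j))) => //.
- by move=> Z Z' U; exact: (cfD hW).
- by move=> a Z U; exact: (cfZ hW).
- by move=> Z U; exact: (cf12 hW).
move=> i' j'.
apply: (star_vanishing (gformC symG) (gformD G) (gformZ G) hW (@eps2 R p q)
  (@eps_lr R p q) weyl_ricci_flat (admissible_rotate symG (s := s)) admissible_star_frame n3) => //.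
by move=> e f he; apply: admissible_flip.
Qed.

Section Four.
Variables (a b : 'I_n).
Hypothesis ab : a != b.
Hypothesis ab_all : forall x, (x == a) || (x == b).

Lemma star_half_weyl e : admissible G s e -> forall X Y,
  [/\ eps (l a) * W X Y (e (l a)) (e (r a)) + eps (l b) * W X Y (e (l b)) (e (r b)) = 0,
      W X Y (e (l a)) (e (r b)) + W X Y (e (r a)) (e (l b)) = 0 &
      W X Y (e (l a)) (e (l b)) - W X Y (e (r a)) (e (r b)) = 0].
Proof.
move=> ge X Y; have he := ge.1.
have H := star_half hW (@eps2 R p q) (@eps_lr R p q) weyl_ricci_flat
  (fun e (h : admissible G s e) => h.1) (admissible_rotate symG (s := s)) admissible_star_frame ab ab_all ge.
split.
- apply: (frame_linear_zero2 (F := fun X Y => eps (l a) * W X Y (e (l a)) (e (r a))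
    + eps (l b) * W X Y (e (l b)) (e (r b))) he).
  + by move=> x x' y; rewrite !(cfD hW); ring.
  + by move=> t x y; rewrite !(cfZ hW); ring.
  + by move=> x y; rewrite !(cf12 hW x y); ring.
  + by move=> i j; case: (H i j).
- apply: (frame_linear_zero2 (F := fun X Y => W X Y (e (l a)) (e (r b))
    + W X Y (e (r a)) (e (l b))) he).
  + by move=> x x' y; rewrite !(cfD hW); ring.
  + by move=> t x y; rewrite !(cfZ hW); ring.
  + by move=> x y; rewrite !(cf12 hW x y); ring.
  + by move=> i j; case: (H i j).
- apply: (frame_linear_zero2 (F := fun X Y => W X Y (e (l a)) (e (l b))
    - W X Y (e (r a)) (e (r b))) he).
  + by move=> x x' y; rewrite !(cfD hW); ring.
  + by move=> t x y; rewrite !(cfZ hW); ring.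
  + by move=> x y; rewrite !(cf12 hW x y); ring.
  + by move=> i j; case: (H i j).
Qed.

End Four.
End FromStar.

Lemma eps_neq0 i : eps i != 0.
Proof. by apply/eqP => E; have := eps2 R i; rewrite E mul0r => /esym/eqP; rewrite oner_eq0. Qed.

(** Reversing one vector of the frame exchanges the two halves of the bivectors,
    and [star_half_weyl] applies to both frames. *)
Theorem star_weyl_zero_four (a b : 'I_n) : a != b ->
  (forall x, (x == a) || (x == b)) ->
  (forall e, frame e -> star_at K e) -> forall i j k h, C i j k h = 0.
Proof.
move=> ab ab_all H.
have hstar e : admissible G None e -> star_at K e by case=> he _; apply: H.
have H4 e (he : frame e) := star_half_weyl (s := None) hstar ab ab_all (conj he I).
apply: (mform_frame_zero he0) => X Y.
have [A1 A2 A3] := H4 _ he0 X Y.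
have hf := flip_frame (gformC symG) (gformZ G) (r b) he0.
have [B1 B2 B3] := H4 _ hf X Y.
move: B1 B2 B3; rewrite flip_f !flip_out ?lr_neq ?rr_neq // !(cfE hW) => B1 B2 B3.
set x := e0 (l a) in A1 A2 A3 B1 B2 B3; set x' := e0 (r a) in A1 A2 A3 B1 B2 B3.
set y := e0 (l b) in A1 A2 A3 B1 B2 B3; set y' := e0 (r b) in A1 A2 A3 B1 B2 B3.
have z1 : W X Y x x' = 0 by apply: (mulfI (eps_neq0 (l a))); lra.
have z2 : W X Y y y' = 0 by apply: (mulfI (eps_neq0 (l b))); lra.
have z3 : W X Y x y' = 0 by lra.
have z4 : W X Y x' y = 0 by lra.
have z5 : W X Y x y = 0 by lra.
have z6 : W X Y x' y' = 0 by lra.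
by apply: lr_case => i; apply: lr_case => j; case/orP: (ab_all i) => /eqP->;
  case/orP: (ab_all j) => /eqP->; rewrite -/x -/y -/x' -/y';
  rewrite ?(cf44 hW) ?(cf34 hW x x') ?(cf34 hW x y) ?(cf34 hW x y')
   ?(cf34 hW y y') ?z1 ?z2 ?z3 ?z4 ?z5 ?z6 ?oppr0 //;
  rewrite (cf34 hW) ?z1 ?z2 ?z3 ?z4 ?z5 ?z6 oppr0.
Qed.

End PointwiseWeyl.

(** * The Hodge operator in dimension four *)
Section Det4.
Variable R : comNzRingType.
Lemma det4 (d : nat) (f : nat -> nat -> R) : d = 4%N ->
  \det (\matrix_(i < d, k < d) f i k) =
  f 0 0 * (f 1 1 * (f 2 2 * f 3 3 - f 2 3 * f 3 2)
         - f 1 2 * (f 2 1 * f 3 3 - f 2 3 * f 3 1)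
         + f 1 3 * (f 2 1 * f 3 2 - f 2 2 * f 3 1))
  - f 0 1 * (f 1 0 * (f 2 2 * f 3 3 - f 2 3 * f 3 2)
         - f 1 2 * (f 2 0 * f 3 3 - f 2 3 * f 3 0)
         + f 1 3 * (f 2 0 * f 3 2 - f 2 2 * f 3 0))
  + f 0 2 * (f 1 0 * (f 2 1 * f 3 3 - f 2 3 * f 3 1)
         - f 1 1 * (f 2 0 * f 3 3 - f 2 3 * f 3 0)
         + f 1 3 * (f 2 0 * f 3 1 - f 2 1 * f 3 0))
  - f 0 3 * (f 1 0 * (f 2 1 * f 3 2 - f 2 2 * f 3 1)
         - f 1 1 * (f 2 0 * f 3 2 - f 2 2 * f 3 0)
         + f 1 2 * (f 2 0 * f 3 1 - f 2 1 * f 3 0)).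
Proof.
move=> ->; rewrite (expand_det_row _ ord0) !big_ord_recl big_ord0 /cofactor /=.
rewrite !(expand_det_row _ ord0) !big_ord_recl !big_ord0 /cofactor /=.
rewrite !(expand_det_row _ ord0) !big_ord_recl !big_ord0 /cofactor /=.
rewrite !det_mx11 !mxE /= /bump /= !addr0.
rewrite ?(expr0, expr1, expr2, exprS).
ring.
Qed.
End Det4.

Section TwoForms.
Variables (R : realType) (p q : nat).
Local Notation n := (p + q)%N.
Local Notation m := (p + q + (p + q))%N.
Local Notation l := (@lshift (p + q) (p + q)).
Local Notation r := (@rshift (p + q) (p + q)).
Local Notation eps := (eps R (p := p) (q := q)).
Local Notation gform := (gform (p := p) (q := q)).
Local Notation frame_mx := (frame_mx (p := p) (q := q)).
Variables (G : 'M[R]_m) (symG : G^T = G).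
Local Notation frame := (orthoframe (gform G) eps).
Implicit Types (B : 'M[R]_m) (X Y : 'cV[R]_m).

Lemma fevalD B X X' Y : feval B (X + X') Y = feval B X Y + feval B X' Y.
Proof. exact: gformD. Qed.
Lemma fevalZ B t X Y : feval B (t *: X) Y = t * feval B X Y.
Proof. exact: gformZ. Qed.
Lemma fevalD2 B X Y Y' : feval B X (Y + Y') = feval B X Y + feval B X Y'.
Proof. by rewrite /feval mulmxDr mxE. Qed.
Lemma fevalZ2 B t X Y : feval B X (t *: Y) = t * feval B X Y.
Proof. by rewrite /feval -scalemxAr mxE. Qed.
Lemma fevalA B X Y : two_form B -> feval B Y X = - feval B X Y.
Proof.
move=> hB; rewrite /feval -[in LHS](trmxK (Y^T *m B *m X)) mxE !trmx_mul hB trmxK.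
by rewrite mulNmx mulmxN mulmxA mxE.
Qed.
Lemma feval0 B X : two_form B -> feval B X X = 0.
Proof. by move=> hB; have := fevalA X X hB; lra. Qed.
Lemma feval_scale B t X Y : feval (t *: B) X Y = t * feval B X Y.
Proof. by rewrite /feval -scalemxAr -scalemxAl mxE. Qed.

Lemma feval_delta B i j : feval B (delta_mx i 0) (delta_mx j 0) = B i j.
Proof. by rewrite /feval -delta_entry. Qed.

Variable e : 'I_m -> 'cV[R]_m.
Hypothesis he : frame e.
Let xi := frame_mx e.

Lemma two_form_frame B : (forall i j, feval B (e j) (e i) = - feval B (e i) (e j)) ->
  two_form B.
Proof.
move=> H; apply/matrixP => i j; rewrite !mxE -!feval_delta; apply/eqP.
rewrite -addr_eq0; apply/eqP.
apply: (frame_linear_zero (K := fun Y => feval B Y (delta_mx i 0)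
   + feval B (delta_mx i 0) Y) he).
- by move=> X Y; rewrite fevalD fevalD2; ring.
- by move=> t X; rewrite fevalZ fevalZ2; ring.
move=> j'; apply: (frame_linear_zero (K := fun Y => feval B (e j') Y
   + feval B Y (e j')) he).
- by move=> X Y; rewrite fevalD fevalD2; ring.
- by move=> t X; rewrite fevalZ fevalZ2; ring.
by move=> i'; rewrite H; ring.
Qed.

Lemma frame_feval B i j : (xi^T *m B *m xi) i j = feval B (e i) (e j).
Proof. exact: frame_gram. Qed.

Lemma raised_form B : invmx G *m B *m (invmx G)^T
  = xi *m (g0 R p q *m (xi^T *m B *m xi) *m g0 R p q) *m xi^T.
Proof.
have sH : (invmx G)^T = invmx G by rewrite trmx_inv symG.
by rewrite sH (inv_metric he) !mulmxA.
Qed.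

Lemma two_form_inner_frame B B' : two_form_inner G B B'
  = 2^-1 * \sum_i \sum_j eps i * eps j * feval B (e i) (e j) * feval B' (e i) (e j).
Proof.
rewrite /two_form_inner; congr (_ * _).
have sH : (invmx G)^T = invmx G by rewrite trmx_inv symG.
rewrite sH (inv_metric he).
have -> : \tr (B *m (xi *m g0 R p q *m xi^T) *m B'^T *m (xi *m g0 R p q *m xi^T))
  = \tr ((xi^T *m B *m xi) *m g0 R p q *m ((xi^T *m B' *m xi)^T *m g0 R p q)).
  by rewrite 2!trmx_mul trmxK !mulmxA [LHS]mxtrace_mulC !mulmxA.
apply: eq_bigr => i _; rewrite mxE; apply: eq_bigr => j _.
by rewrite !mul_g0 [_^T _ _]mxE !frame_feval; ring.
Qed.

Lemma mform_delta2 T i j X Y : mform T (delta_mx i 0) (delta_mx j 0) X Y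
  = \sum_k \sum_h T i j k h * (X k 0 * Y h 0) :> R.
Proof.
rewrite /mform -[RHS](sum_delta (fun i => \sum_k \sum_h T i j k h * (X k 0 * Y h 0)) i).
apply: eq_bigr => i' _.
rewrite -(sum_delta (fun j => \sum_k \sum_h T i' j k h * (X k 0 * Y h 0)) j) mulr_suml.
apply: eq_bigr => j' _; rewrite !mulr_suml; apply: eq_bigr => k _.
by rewrite !mulr_suml; apply: eq_bigr => h _; ring.
Qed.

Lemma two_form_action_frame T B i j : two_form_action G T B i j
  = 2^-1 * \sum_x \sum_y eps x * eps y * feval B (e x) (e y)
     * mform T (delta_mx i 0) (delta_mx j 0) (e x) (e y).
Proof.
rewrite mxE raised_form; congr (_ * _).
transitivity (\sum_x \sum_y \sum_k \sum_h eps x * eps y * feval B (e x) (e y)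
   * (T i j k h * (e x k 0 * e y h 0))); last first.
  apply: eq_bigr => x _; apply: eq_bigr => y _; rewrite mform_delta2 mulr_sumr.
  by apply: eq_bigr => k _; rewrite mulr_sumr.
transitivity (\sum_k \sum_h \sum_x \sum_y eps x * eps y * feval B (e x) (e y)
   * (T i j k h * (e x k 0 * e y h 0))).
  apply: eq_bigr => k _; apply: eq_bigr => h _.
  rewrite -(mulmxA xi) mxE mulr_sumr; apply: eq_bigr => x _.
  rewrite [(_ *m xi^T) x h]mxE !mulr_sumr; apply: eq_bigr => y _.
  by rewrite mul_g0 g0_mul frame_feval !mxE; ring.
under eq_bigr do rewrite exchange_big.
rewrite exchange_big; apply: eq_bigr => x _ /=.
under eq_bigr do rewrite exchange_big.
by rewrite exchange_big.
Qed.

End TwoForms.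

Section HodgeFour.
Variables (R : realType) (p q : nat).
Local Notation n := (p + q)%N.
Local Notation m := (p + q + (p + q))%N.
Local Notation l := (@lshift (p + q) (p + q)).
Local Notation r := (@rshift (p + q) (p + q)).
Local Notation eps := (eps R (p := p) (q := q)).
Local Notation gform := (gform (p := p) (q := q)).
Local Notation frame_mx := (frame_mx (p := p) (q := q)).
Variables (G : 'M[R]_m) (symG : G^T = G).
Local Notation frame := (orthoframe (gform G) eps).
Hypothesis n2 : n = 2%N.
Variables (a b : 'I_n).
Hypotheses (va : val a = 0%N) (vb : val b = 1%N).
Variable s : R.
Hypothesis hs : s = 1 \/ s = -1.
Variable e : 'I_m -> 'cV[R]_m.
Hypothesis ge : admissible G (Some s) e.
Let he : frame e := ge.1.
Let xi := frame_mx e.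
Local Notation al := (eps (l a)).
Local Notation be := (eps (l b)).

Lemma ab_neq : a != b.
Proof. by apply/eqP => /(congr1 val); rewrite va vb. Qed.

Lemma ab_cover x : (x == a) || (x == b).
Proof.
have : (x < 2)%N by rewrite -[X in (_ < X)%N]n2.
case E : (val x) => [|[|//]] _.
  by apply/orP; left; apply/eqP/val_inj; rewrite va.
by apply/orP; right; apply/eqP/val_inj; rewrite vb.
Qed.

Definition crd (i : 'I_m) (X : 'cV[R]_m) : R := eps i * gform G (e i) X.

(** Coordinates and frame vectors numbered by nat, in the order
    x, y, x', y' of the index type, to match the vectors X 0, ..., X 3 of the
    volume form. *)
Definition nth_crd (k : nat) (X : 'cV[R]_m) : R :=
  match k with 0 => crd (l a) X | 1 => crd (l b) X
  | 2 => crd (r a) X | _ => crd (r b) X end.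

Definition nth_index (k : nat) : 'I_m :=
  match k with 0 => l a | 1 => l b | 2 => r a | _ => r b end.

Lemma crd_nth i X : crd i X = nth_crd i X.
Proof.
move: i; apply: lr_case => x; case/orP: (ab_cover x) => /eqP->.
- by rewrite /nth_crd (_ : nat_of_ord (l a) = 0%N).
- by rewrite /nth_crd (_ : nat_of_ord (l b) = 1%N).
- by rewrite /nth_crd (_ : nat_of_ord (r a) = 2%N) //= va n2.
- by rewrite /nth_crd (_ : nat_of_ord (r b) = 3%N) //= vb n2.
Qed.

Lemma nth_indexE (i : 'I_m) : nth_index i = i.
Proof.
move: i; apply: lr_case => x; case/orP: (ab_cover x) => /eqP->.
- by rewrite /nth_index (_ : nat_of_ord (l a) = 0%N).
- by rewrite /nth_index (_ : nat_of_ord (l b) = 1%N).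
- by rewrite /nth_index (_ : nat_of_ord (r a) = 2%N) //= va n2.
- by rewrite /nth_index (_ : nat_of_ord (r b) = 3%N) //= vb n2.
Qed.

Lemma sum_four (F : 'I_m -> R) :
  \sum_i F i = F (l a) + F (l b) + (F (r a) + F (r b)).
Proof. by rewrite big_split_ord /= !(sum_ab ab_neq ab_cover). Qed.

Lemma expand_four X : X = nth_crd 0 X *: e (l a) + nth_crd 1 X *: e (l b)
  + nth_crd 2 X *: e (r a) + nth_crd 3 X *: e (r b).
Proof.
rewrite {1}(frame_expand he X); apply/matrixP => i j.
rewrite summxE sum_four !mxE /nth_crd /crd; ring.
Qed.

Lemma feval_four B X Y : two_form B ->
  feval B X Y =
    feval B (e (l a)) (e (l b)) * (nth_crd 0 X * nth_crd 1 Y - nth_crd 1 X * nth_crd 0 Y)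
  + feval B (e (l a)) (e (r a)) * (nth_crd 0 X * nth_crd 2 Y - nth_crd 2 X * nth_crd 0 Y)
  + feval B (e (l a)) (e (r b)) * (nth_crd 0 X * nth_crd 3 Y - nth_crd 3 X * nth_crd 0 Y)
  + feval B (e (l b)) (e (r a)) * (nth_crd 1 X * nth_crd 2 Y - nth_crd 2 X * nth_crd 1 Y)
  + feval B (e (l b)) (e (r b)) * (nth_crd 1 X * nth_crd 3 Y - nth_crd 3 X * nth_crd 1 Y)
  + feval B (e (r a)) (e (r b)) * (nth_crd 2 X * nth_crd 3 Y - nth_crd 3 X * nth_crd 2 Y).
Proof.
move=> hB; rewrite [in LHS](expand_four X) [in LHS](expand_four Y).
rewrite !(fevalD, fevalZ, fevalD2, fevalZ2) !(feval0 _ hB).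
rewrite (fevalA (e (l a)) (e (l b)) hB) (fevalA (e (l a)) (e (r a)) hB).
rewrite (fevalA (e (l a)) (e (r b)) hB) (fevalA (e (l b)) (e (r a)) hB).
rewrite (fevalA (e (l b)) (e (r b)) hB) (fevalA (e (r a)) (e (r b)) hB).
ring.
Qed.

Lemma inner_four B B' : two_form B -> two_form B' ->
  two_form_inner G B B' =
    al * be * feval B (e (l a)) (e (l b)) * feval B' (e (l a)) (e (l b))
  + feval B (e (l a)) (e (r a)) * feval B' (e (l a)) (e (r a))
  + al * be * feval B (e (l a)) (e (r b)) * feval B' (e (l a)) (e (r b))
  + al * be * feval B (e (l b)) (e (r a)) * feval B' (e (l b)) (e (r a))
  + feval B (e (l b)) (e (r b)) * feval B' (e (l b)) (e (r b))
  + al * be * feval B (e (r a)) (e (r b)) * feval B' (e (r a)) (e (r b)).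
Proof.
move=> hB hB'; rewrite (two_form_inner_frame symG he) !sum_four !(feval0 _ hB) !mulr0 !mul0r.
rewrite (fevalA (e (l a)) (e (l b)) hB) (fevalA (e (l a)) (e (r a)) hB).
rewrite (fevalA (e (l a)) (e (r b)) hB) (fevalA (e (l b)) (e (r a)) hB).
rewrite (fevalA (e (l b)) (e (r b)) hB) (fevalA (e (r a)) (e (r b)) hB).
rewrite (fevalA (e (l a)) (e (l b)) hB') (fevalA (e (l a)) (e (r a)) hB').
rewrite (fevalA (e (l a)) (e (r b)) hB') (fevalA (e (l b)) (e (r a)) hB').
rewrite (fevalA (e (l b)) (e (r b)) hB') (fevalA (e (r a)) (e (r b)) hB').
rewrite !eps_lr.
by case: (eps_sign (@eps2 R p q) (l a)) => ->; case: (eps_sign (@eps2 R p q) (l b)) => ->; field.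
Qed.

(** The volume form takes the value 1 on a positively oriented frame. *)
Lemma vol_normalised : s * Num.sqrt `|\det G| * \det xi = 1.
Proof.
have g2 : `|\det (g0 R p q)| = 1.
  have : \det (g0 R p q) * \det (g0 R p q) = 1 by rewrite -det_mulmx g0_sqr det1.
  move=> E; have : `|\det (g0 R p q)| ^+ 2 = 1 by rewrite -normrX expr2 E normr1.
  by move/eqP; rewrite sqrp_eq1 // => /eqP.
have dG : \det xi ^+ 2 * `|\det G| = 1.
  rewrite -g2 -((orthoframeP _ _).1 he) !det_mulmx det_tr -/xi !normrM.
  rewrite -[`|\det xi| * _ * _]mulrA [`|\det G| * _]mulrC mulrA -expr2.
  by rewrite real_normK ?num_real.
have sd : s * \det xi = `|\det xi|.
  have := ge.2; rewrite -/xi => h; rewrite -(gtr0_norm h) normrM.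
  by case: hs => ->; rewrite ?normrN normr1 mul1r.
rewrite mulrAC sd -sqrtr_sqr -sqrtrM ?sqr_ge0 // dG.
exact: sqrtr1.
Qed.

Lemma vol_four (X : nat -> 'cV[R]_m) : vol G s X
  = \det (\matrix_(i < m, k < m) nth_crd i (X k)).
Proof.
rewrite /vol.
have -> : (\matrix_(i, k) X k i 0) = xi *m (\matrix_(i < m, k < m) nth_crd i (X k)) :> 'M[R]_m.
  apply/matrixP => i k; rewrite mxE [in LHS](frame_expand he (X k)) summxE mxE.
  by apply: eq_bigr => j _; rewrite !mxE -crd_nth mulrC.
by rewrite det_mulmx mulrA vol_normalised mul1r.
Qed.

Lemma dim_four : m = 4%N. Proof. by rewrite n2. Qed.

Lemma nth_crd_frame k i : nth_crd k (e i) = (nth_index k == i)%:R.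
Proof.
have E j : crd j (e i) = (j == i)%:R.
  by rewrite /crd he; have [_|_] := eqVneq j i; rewrite ?mulr1n ?eps2 ?mulr0.
by case: k => [|[|[|k]]]; rewrite /nth_crd /nth_index E.
Qed.

(** The equation of an eigenform for the eigenvalue t, read off on the frame.  For
    t = - al be it says that the bivector obtained from B by raising the indices
    lies in the span of j_U, k and k'. *)
Definition hodge_relations (t : R) (B : 'M[R]_m) : Prop :=
  [/\ t * feval B (e (r a)) (e (r b)) = al * be * feval B (e (l a)) (e (l b)),
      - (t * feval B (e (l b)) (e (r b))) = feval B (e (l a)) (e (r a)) &
      t * feval B (e (l b)) (e (r a)) = al * be * feval B (e (l a)) (e (r b))].

(** The exterior product of the covectors dual to u and v by the metric. *)
Definition ext_form (u v : 'cV[R]_m) : 'M[R]_m := G *m (u *m v^T - v *m u^T) *m G.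

Lemma ext_form_two u v : two_form (ext_form u v).
Proof.
rewrite /two_form /ext_form !trmx_mul symG linearB /= !trmx_mul !trmxK.
by rewrite mulmxA -[RHS]mulNmx -[X in _ = X *m _]mulmxN opprB.
Qed.

Lemma feval_ext u v X Y : feval (ext_form u v) X Y
  = gform G X u * gform G v Y - gform G X v * gform G u Y.
Proof.
have E (A B C : 'cV[R]_m) (D : 'cV[R]_m) : (A^T *m (G *m (B *m C^T) *m G) *m D) 0 0 =
    gform G A B * gform G C D.
  rewrite /gform; have -> : A^T *m (G *m (B *m C^T) *m G) *m D
    = (A^T *m G *m B) *m (C^T *m G *m D) by rewrite !mulmxA.
  by rewrite mxE big_ord1.
rewrite /feval /ext_form mulmxBr mulmxBl mulmxBr mulmxBl.
by rewrite mxE [X in _ + X]mxE !E.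
Qed.

Lemma feval_ext_frame i j k h : feval (ext_form (e i) (e j)) (e k) (e h)
  = eps i * eps j * ((k == i)%:R * (j == h)%:R - (k == j)%:R * (i == h)%:R).
Proof.
have gE x y : gform G (e x) (e y) = eps y * (x == y)%:R.
  by rewrite he; have [->|_] := eqVneq x y; rewrite ?mulr1 ?mulr0.
have gE' x y : gform G (e x) (e y) = eps x * (x == y)%:R.
  by rewrite he; have [_|_] := eqVneq x y; rewrite ?mulr1 ?mulr0.
by rewrite feval_ext (gE k i) (gE' j h) (gE k j) (gE' i h); ring.
Qed.

Lemma frame_neq : ((l a == l b) = false) * ((l b == l a) = false)
  * ((r a == r b) = false) * ((r b == r a) = false)
  * (forall x y : 'I_n, (l x == r y) = false) * (forall x y : 'I_n, (r x == l y) = false).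
Proof.
have h := ab_neq; have h' : b != a by rewrite eq_sym.
do !split; rewrite ?eq_lshift ?eq_rshift; try exact: negbTE.
  by move=> x y; rewrite eq_lrshift.
by move=> x y; rewrite eq_rlshift.
Qed.

(** Pairing B with the exterior products of x with y, x' and y' and evaluating
    on the frame gives the three relations. *)
Lemma is_hodge_relations t B : two_form B -> is_hodge G s B (t *: B) ->
  hodge_relations t B.
Proof.
move=> hB [_ H].
have key i j : wedge (ext_form (e i) (e j)) (t *: B) (e (l a)) (e (l b)) (e (r a)) (e (r b))
    = two_form_inner G (ext_form (e i) (e j)) B.
  have := H _ (ext_form_two (e i) (e j)) (fun k => e (nth_index k)).
  rewrite vol_four (_ : \matrix_(i < m, k < m) _ = 1%:M) ?det1 ?mulr1 //.
  by apply/matrixP => i' k; rewrite !mxE nth_crd_frame !nth_indexE.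
have := key (l a) (l b); have := key (l a) (r a); have := key (l a) (r b).
rewrite !(inner_four (ext_form_two _ _) hB) /wedge !feval_scale !feval_ext_frame.
rewrite !eqxx !frame_neq /= !(mulr1, mulr0, mul0r, subr0, add0r, addr0, sub0r, oppr0).
rewrite /hodge_relations !eps_lr.
case: (eps_sign (@eps2 R p q) (l a)) => ->; case: (eps_sign (@eps2 R p q) (l b)) => -> A1 A2 A3;
  split; lra.
Qed.

Lemma feval_J X Y : feval (G *m pi1 xi) X Y = gform G X (pi1 xi *m Y).
Proof. by rewrite /feval /gform !mulmxA. Qed.

Lemma gformN X Y : gform G X (- Y) = - gform G X Y.
Proof. by rewrite /gform mulmxN mxE. Qed.

Lemma two_form_J : two_form (G *m pi1 xi).
Proof.
apply: (two_form_frame he).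
by apply: lr_case => x; apply: lr_case => y;
  rewrite !feval_J ?(J_l he) ?(J_r he) ?gformN !he
    ?eq_lrshift ?eq_rlshift ?eq_lshift ?eq_rshift ?mulr0n ?oppr0 // ?eps_lr
    ?opprK [x == y]eq_sym; case: eqVneq => [->|]; rewrite ?mulr0n ?oppr0.
Qed.

(** G j is the two-form g(., j .).  Both sides are alternating in the four
    vectors, and in frame coordinates the determinant is explicit. *)
Lemma hodge_J (t : R) : t = - (al * be) ->
  is_hodge G s (G *m pi1 xi) (t *: (G *m pi1 xi)).
Proof.
move=> ht.
have hB := two_form_J.
split; first by rewrite /two_form linearZ /= hB scalerN.
move=> A hA X; rewrite vol_four (det4 (fun i k => nth_crd i (X k)) dim_four) (inner_four hA hB).
have fJ X' Y' : feval (G *m pi1 xi) X' Y' =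
    - al * (nth_crd 0 X' * nth_crd 2 Y' - nth_crd 2 X' * nth_crd 0 Y')
    - be * (nth_crd 1 X' * nth_crd 3 Y' - nth_crd 3 X' * nth_crd 1 Y').
  rewrite (feval_four X' Y' hB) !feval_J !(J_l he) !(J_r he) !gformN !he.
  by rewrite !eqxx !frame_neq !mulr1n !mulr0n; ring.
rewrite /wedge !feval_scale !fJ !nth_crd_frame /nth_index !eqxx !frame_neq ht.
rewrite (feval_four (X 0%N) (X 1%N) hA) (feval_four (X 0%N) (X 2%N) hA) (feval_four (X 0%N) (X 3%N) hA)
  (feval_four (X 1%N) (X 2%N) hA) (feval_four (X 1%N) (X 3%N) hA) (feval_four (X 2%N) (X 3%N) hA).
move: (feval A (e (l a)) (e (l b))) (feval A (e (l a)) (e (r a)))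
  (feval A (e (l a)) (e (r b))) (feval A (e (l b)) (e (r a)))
  (feval A (e (l b)) (e (r b))) (feval A (e (r a)) (e (r b))) => A01 A02 A03 A12 A13 A23.
move: (nth_crd 0 (X 0%N)) (nth_crd 1 (X 0%N)) (nth_crd 2 (X 0%N)) (nth_crd 3 (X 0%N)) => x0 x1 x2 x3.
move: (nth_crd 0 (X 1%N)) (nth_crd 1 (X 1%N)) (nth_crd 2 (X 1%N)) (nth_crd 3 (X 1%N)) => y0 y1 y2 y3.
move: (nth_crd 0 (X 2%N)) (nth_crd 1 (X 2%N)) (nth_crd 2 (X 2%N)) (nth_crd 3 (X 2%N)) => z0 z1 z2 z3.
move: (nth_crd 0 (X 3%N)) (nth_crd 1 (X 3%N)) (nth_crd 2 (X 3%N)) (nth_crd 3 (X 3%N)) => w0 w1 w2 w3 /=.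
by case: (eps_sign (@eps2 R p q) (l a)) => ->;
  case: (eps_sign (@eps2 R p q) (l b)) => ->; ring.
Qed.

End HodgeFour.

(** * The condition at a point in dimension four *)
Section PointwiseHodge.
Variables (R : realType) (p q : nat).
Local Notation n := (p + q)%N.
Local Notation m := (p + q + (p + q))%N.
Local Notation l := (@lshift (p + q) (p + q)).
Local Notation r := (@rshift (p + q) (p + q)).
Local Notation eps := (eps R (p := p) (q := q)).
Local Notation gform := (gform (p := p) (q := q)).
Local Notation frame_mx := (frame_mx (p := p) (q := q)).
Variables (G : 'M[R]_m) (symG : G^T = G).
Local Notation frame := (orthoframe (gform G) eps).
Variable Rm : 'I_m -> 'I_m -> 'I_m -> 'I_m -> R.
Hypothesis hR : curvature_tensor Rm.
Variable K : 'cV[R]_m -> 'cV[R]_m -> 'M[R]_m.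
Hypothesis hK : forall X Y Z Z', gform G Z' (K X Y *m Z) = mform Rm X Y Z Z'.
Variable e0 : 'I_m -> 'cV[R]_m.
Hypothesis he0 : frame e0.
Hypothesis n2 : n = 2%N.
Variables (a b : 'I_n).
Hypotheses (va : val a = 0%N) (vb : val b = 1%N).
Variable s : R.
Hypothesis hs : s = 1 \/ s = -1.
Local Notation C := (weyl G Rm).
Local Notation W := (mform (weyl G Rm)).
Let hW : curvature_form W := mform_curvature (weyl_curvature_tensor symG hR).
Let n2' : (2 <= n)%N. Proof. by rewrite n2. Qed.

Lemma delta_linear_zero (F : 'cV[R]_m -> R) :
  (forall X Y, F (X + Y) = F X + F Y) -> (forall t X, F (t *: X) = t * F X) ->
  (forall i, F (delta_mx i 0) = 0) -> forall X, F X = 0.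
Proof.
move=> FD FZ F0 X.
have F00 : F 0 = 0 by rewrite -(scale0r 0) FZ mul0r.
rewrite (matrix_sum_delta X); elim/big_rec: _ => // i Y _ E.
by rewrite FD E big_ord1 FZ F0 mulr0 addr0.
Qed.

(** From left to right, the raised form of an eigenform of the Hodge operator is
    a combination of j_U, k and k', which C annihilates by [star_half_weyl].
    From right to left, the two-form of each j is an eigenform by [hodge_J], so
    C annihilates j and both sides of the condition vanish. *)
Theorem star_hodge :
  (forall e, admissible G (Some s) e -> star_at K e) <->
  vanishes_on_eigenspace G s C (- (eps (l a) * eps (l b))).
Proof.
have s0 : s != 0 by case: hs => ->; rewrite ?oppr_eq0 oner_eq0.
split=> H.
  move=> B hB hodge.
  have [e ge] : exists e, admissible G (Some s) e.
    by have [|] := admissible_flip symG (s := Some s) (l a) s0 he0 => ge; eexists; exact: ge.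
  have [r1 r2 r3] := is_hodge_relations symG n2 va vb hs ge hB hodge.
  apply/matrixP => i j; rewrite (two_form_action_frame symG ge.1) mxE.
  have [h1 h2 h3] := star_half_weyl symG hR hK he0 n2' H (ab_neq va vb)
    (ab_cover n2 va vb) ge (delta_mx i 0) (delta_mx j 0).
  rewrite !(sum_four n2 va vb) !(feval0 _ hB) !(cf44 hW) !mulr0.
  rewrite (fevalA (e (l a)) (e (l b)) hB) (fevalA (e (l a)) (e (r a)) hB).
  rewrite (fevalA (e (l a)) (e (r b)) hB) (fevalA (e (l b)) (e (r a)) hB).
  rewrite (fevalA (e (l b)) (e (r b)) hB) (fevalA (e (r a)) (e (r b)) hB).
  rewrite !(cf21 hW (e (l a)) (e (l b))) !(cf21 hW (e (l a)) (e (r a))).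
  rewrite !(cf21 hW (e (l a)) (e (r b))) !(cf21 hW (e (l b)) (e (r a))).
  rewrite !(cf21 hW (e (l b)) (e (r b))) !(cf21 hW (e (r a)) (e (r b))).
  rewrite !eps_lr.
  rewrite (cf34 hW _ _ (e (l b)) (e (r a))) in h2.
  move: r1 r2 r3 h1 h2 h3.
  move: (feval B (e (l a)) (e (l b))) (feval B (e (l a)) (e (r a)))
    (feval B (e (l a)) (e (r b))) (feval B (e (l b)) (e (r a)))
    (feval B (e (l b)) (e (r b))) (feval B (e (r a)) (e (r b))) => b1 b2 b3 b4 b5 b6.
  move: (W _ _ (e (l a)) (e (l b))) (W _ _ (e (l a)) (e (r a)))
    (W _ _ (e (l a)) (e (r b))) (W _ _ (e (l b)) (e (r a)))
    (W _ _ (e (l b)) (e (r b))) (W _ _ (e (r a)) (e (r b))) => w1 w2 w3 w4 w5 w6.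
  by case: (eps_sign (@eps2 R p q) (l a)) => ->;
    case: (eps_sign (@eps2 R p q) (l b)) => -> r1 r2 r3 h1 h2 h3;
    (have -> : b6 = - b1 by lra); (have -> : b4 = - b3 by lra);
    (have -> : w4 = w3 by lra); (have -> : w6 = w1 by lra);
    (have -> : b2 = - b5 by lra) || (have -> : b2 = b5 by lra);
    (have -> : w2 = - w5 by lra) || (have -> : w2 = w5 by lra); ring.
move=> e ge; have he := ge.1.
have hB := two_form_J ge.
have act := H _ hB (hodge_J symG n2 va vb hs ge erefl).
apply: (star_form_zero_at symG hR hK he) => X Y.
have gN X' Y' : gform G X' (- Y') = - gform G X' Y' by rewrite /gform mulmxN mxE.
have fJ := feval_J G e; have nE := frame_neq va vb.
have base i j : star_form W eps e (delta_mx i 0) (delta_mx j 0) = 0.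
  have := congr1 (fun A : 'M[R]_m => A i j) act.
  rewrite (two_form_action_frame symG he) mxE /star_form.
  rewrite (sum_ab (ab_neq va vb) (ab_cover n2 va vb)) !(sum_four n2 va vb).
  rewrite !(cf44 hW) !fJ !(J_l he) !(J_r he) !gN !he !eqxx !nE !mulr1n !mulr0n.
  rewrite !(cf21 hW (e (l a)) (e (r a))) !(cf21 hW (e (l b)) (e (r b))) !eps_lr.
  by case: (eps_sign (@eps2 R p q) (l a)) => ->;
    case: (eps_sign (@eps2 R p q) (l b)) => ->; lra.
apply: (delta_linear_zero (F := fun X => star_form W eps e X Y)).
- move=> X1 X2; rewrite /star_form -big_split; apply: eq_bigr => x _ /=.
  by rewrite (cfD hW) mulrDr.
- move=> t X1; rewrite /star_form mulr_sumr; apply: eq_bigr => x _ /=.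
  by rewrite (cfZ hW) mulrCA.
move=> i; apply: (delta_linear_zero (F := fun Y => star_form W eps e _ Y)) => //.
- move=> X1 X2; rewrite /star_form -big_split; apply: eq_bigr => x _ /=.
  by rewrite (cfD2 hW) mulrDr.
- move=> t X1; rewrite /star_form mulr_sumr; apply: eq_bigr => x _ /=.
  by rewrite (cfZ2 hW) mulrCA.
Qed.
End PointwiseHodge.

(** * The condition on a manifold *)
Section Manifold.
Variables (R : realType) (p q : nat) (M : manifold R (p + q + (p + q))).
Variables (g : pseudo_metric M) (D : connection M).
Local Notation m := (p + q + (p + q))%N.
Local Notation eps := (eps R (p := p) (q := q)).
Local Notation frame_mx := (frame_mx (p := p) (q := q)).
Local Notation gform := (gform (p := p) (q := q)).

Lemma curv_scale (a : mindex M) x t (X Y : 'cV[R]_m) :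
  curv D a x (t *: X) (t *: Y) = (t * t) *: curv D a x X Y.
Proof.
rewrite /curv scaler_sumr; apply: eq_bigr => i _; rewrite scaler_sumr.
by apply: eq_bigr => k _; rewrite scalerA !mxE; congr (_ *: _); ring.
Qed.

Lemma vproj_Jnabla s (a : mindex M) pt j Xi :
  vproj D a pt j (Jnabla D s a pt j Xi) = j *m vproj D a pt j Xi.
Proof. by rewrite /vproj /= addrAC subrr add0r. Qed.

(** (j S)(j S') = - j j S S' = S S' as S anticommutes with j. *)
Lemma commutator_J (j S S' : 'M[R]_m) : j *m j = - 1%:M ->
  S *m j + j *m S = 0 -> S' *m j + j *m S' = 0 ->
  (j *m S) *m (j *m S') - (j *m S') *m (j *m S) = S *m S' - S' *m S.
Proof.
move=> jj hS hS'.
have E A B : A *m j + j *m A = 0 -> (j *m A) *m (j *m B) = A *m B.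
  move=> hA; have -> : j *m A = - (A *m j) by apply/eqP; rewrite -addr_eq0 addrC hA.
  by rewrite mulNmx -mulmxA (mulmxA j) jj mulNmx mulmxN opprK mul1mx.
by rewrite !E.
Qed.

(** The trace of the commutator of the vertical parts is invariant by
    [commutator_J], and the signs of J^+ and J^- cancel in the curvature term.
    Conversely, the horizontal lifts have no vertical part and isolate the
    curvature term. *)
Lemma star_compatible (o : option (orientation M)) (s : bool) :
  star_condition g D o <-> compatible g D o s.
Proof.
have sgn : ((-1) ^+ s * (-1) ^+ s : R) = 1 by rewrite -expr2 sqrr_sign.
split=> H pt a ha.
  move=> j hj Xi Xi' tX tX'; rewrite /omega !vproj_Jnabla /=.
  have [xi [u _ _] Ej] := hj.
  rewrite commutator_J; [|by rewrite Ej pi1_sqr|by case: tX|by case: tX'].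
  by rewrite curv_scale sgn scale1r (H pt a ha).
move=> X Y j hj /=.
have V0 Z : vproj D a pt j (hlift D a pt j Z) = 0 by rewrite /vproj subrr.
have T0 Z : twistor_tangent g D a pt j (hlift D a pt j Z).
  rewrite /twistor_tangent /= V0; split; rewrite ?trmx0 ?mul0mx ?mulmx0 addr0 //.
have := H pt a ha j hj _ _ (T0 X) (T0 Y).
rewrite /omega !vproj_Jnabla !V0 !mulmx0 subrr /=.
rewrite curv_scale sgn scale1r => /addIr /(congr1 (@complex.Re R)) /= E.
have n0 : (-2 : R) != 0 by rewrite oppr_eq0 pnatr_eq0.
exact: (mulfI n0).
Qed.

Hypothesis hD : levi_civita g D.

Section AtPoint.
Variables (pt : M) (a : mindex M).
Hypothesis ha : dom a pt.
Let x := chart a pt.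
Let G := gmx g a x.
Let Ux : chart_img a x. Proof. by exists pt. Qed.

Lemma metric_sym : G^T = G.
Proof. exact: gmx_sym. Qed.

Lemma riemann_curvature_tensor : curvature_tensor (riemann_coord g D a x).
Proof.
split=> i j k l; rewrite /riemann_coord.
- by rewrite curv_coord_antisym mulmxN mxE.
- have := curv_coord_skew hD i j Ux; rewrite -/G => /(congr1 (fun A : 'M[R]_m => A k l)).
  have -> : (curv_coord D a x i j)^T *m G = (G *m curv_coord D a x i j)^T.
    by rewrite trmx_mul metric_sym.
  rewrite mxE [_^T _ _]mxE [RHS]mxE => /eqP.
  by rewrite addrC addr_eq0 => /eqP.
rewrite !mxE -!big_split /=; apply: big1 => s _.
by rewrite -!mulrDr (curv_coord_bianchi hD) ?mulr0.
Qed.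

Lemma curv_riemann X Y Z Z' :
  gform G Z' (curv D a x X Y *m Z) = mform (riemann_coord g D a x) X Y Z Z'.
Proof.
rewrite /curv /gform /mform mulmx_suml mulmx_sumr summxE; apply: eq_bigr => i _.
rewrite mulmx_suml mulmx_sumr summxE; apply: eq_bigr => j _.
rewrite -scalemxAl -scalemxAr mxE /riemann_coord mulmxA -(mulmxA Z'^T).
rewrite mxE mulr_sumr; apply: eq_bigr => k _.
rewrite mxE mulr_suml mulr_sumr; apply: eq_bigr => l _.
by rewrite mxE; ring.
Qed.

Lemma exists_frame : exists e, orthoframe (gform G) eps e.
Proof.
have [xi _ E] := gmx_signature g Ux.
by exists (fun k => col k xi); apply/orthoframeP; rewrite col_frame_mx.
Qed.

Definition orientation_sign (o : option (orientation M)) : option R :=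
  omap (fun o' => osign o' a pt) o.

Lemma orientation_sign_neq0 o : sign_option (orientation_sign o).
Proof. by case: o => [or|] //=; rewrite /osign signr_eq0. Qed.

Lemma osign_pm1 (o : orientation M) : osign o a pt = 1 \/ osign o a pt = -1.
Proof. by rewrite /osign; case: (oneg o a pt); [right|left]. Qed.

(** The frames at a point are the admissible frames, written as matrices. *)
Lemma star_at_point o :
  (forall (X Y : 'cV[R]_m) (j : 'M[R]_m), twistor_fibre g o a pt j ->
      let Rc := curv D a x in \tr (Rc (j *m X) (j *m Y) *m j) = \tr (Rc X Y *m j))
  <-> forall e, admissible G (orientation_sign o) e -> star_at (curv D a x) e.
Proof.
split=> H.
  move=> e [he hs] X Y /=; apply: H; exists (frame_mx e) => //; split.
  - exact: unit_frame he.
  - exact: (orthoframeP _ _).1 he.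
  - by case: (o) hs.
move=> X Y j [xi [u hx hs] ->] /=.
have := H (fun k => col k xi); rewrite /star_at col_frame_mx; apply.
split; first by apply/orthoframeP; rewrite col_frame_mx.
by rewrite col_frame_mx; case: (o) hs.
Qed.

Lemma weyl_zero_star_at o : (2 <= p + q)%N ->
  (forall i j k l, weyl_curv g D a pt i j k l = 0) ->
  forall e, admissible G (orientation_sign o) e -> star_at (curv D a x) e.
Proof.
move=> n2 W0 e [he _].
exact: (weyl_zero_star metric_sym riemann_curvature_tensor curv_riemann he).
Qed.

Lemma star_at_weyl_zero o : (2 <= p + q)%N -> o = None \/ (3 <= p + q)%N ->
  (forall e, admissible G (orientation_sign o) e -> star_at (curv D a x) e) ->
  forall i j k l, weyl_curv g D a pt i j k l = 0.
Proof.
move=> n2 n3 H; have [e0 he0] := exists_frame.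
have [h3|h3] := leqP 3 (p + q).
  exact: (star_weyl_zero_high metric_sym riemann_curvature_tensor curv_riemann
    he0 n2 (orientation_sign_neq0 o) H h3).
case: n3 => [on|]; last by rewrite leqNgt h3.
have n2E : (p + q)%N = 2%N by apply/eqP; rewrite eqn_leq n2 -ltnS h3.
have a0 : (0 < p + q)%N by rewrite n2E.
apply: (star_weyl_zero_four metric_sym riemann_curvature_tensor curv_riemann
    he0 n2 (@ab_neq p q (Ordinal a0) (Ordinal n2) erefl erefl)
    (@ab_cover p q n2E (Ordinal a0) (Ordinal n2) erefl erefl)).
by move=> e he; apply: H; split; rewrite ?on.
Qed.

Lemma star_at_hodge (o : orientation M) (n2 : (p + q)%N = 2%N) (i j : 'I_(p + q)) :
  val i = 0%N -> val j = 1%N ->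
  (forall e, admissible G (orientation_sign (Some o)) e -> star_at (curv D a x) e) <->
  vanishes_on_eigenspace G (osign o a pt) (weyl_curv g D a pt)
    (- (Ipq R p q i i * Ipq R p q j j)).
Proof.
move=> vi vj; have [e0 he0] := exists_frame; rewrite -!eps_l.
exact: (star_hodge metric_sym riemann_curvature_tensor curv_riemann
    he0 n2 vi vj (osign_pm1 o)).
Qed.

End AtPoint.

Lemma star_hodge_condition (o : orientation M) (t : R) (i j : 'I_(p + q)) :
  (p + q)%N = 2%N -> val i = 0%N -> val j = 1%N ->
  t = - (Ipq R p q i i * Ipq R p q j j) ->
  star_condition g D (Some o) <->
  forall (pt : M) (a : mindex M), dom a pt ->
    vanishes_on_eigenspace (gmx g a (chart a pt)) (osign o a pt)
      (weyl_curv g D a pt) t.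
Proof.
move=> n2 vi vj ->; split=> H pt a ha.
  by apply/(star_at_hodge ha o n2 vi vj)/star_at_point; apply: H.
by apply/star_at_point/(star_at_hodge ha o n2 vi vj); apply: H.
Qed.

End Manifold.

Lemma Ipq_lt (R : realType) (p q : nat) (i : 'I_(p + q)) : (i < p)%N ->
  Ipq R p q i i = 1.
Proof.
move=> ip; have -> : i = lshift q (Ordinal ip) by exact: val_inj.
by rewrite /Ipq block_mxEul mxE eqxx.
Qed.

Lemma Ipq_ge (R : realType) (p q : nat) (i : 'I_(p + q)) : (p <= i)%N ->
  Ipq R p q i i = -1.
Proof.
move=> pi; have iq : (i - p < q)%N by rewrite -(ltn_add2l p) subnKC.
have -> : i = rshift p (Ordinal iq) by apply: val_inj; rewrite /= subnKC.
by rewrite /Ipq block_mxEdr !mxE eqxx.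
Qed.

Theorem proposition5p8 (R : realType) (p q : nat)
    (M : manifold R (p + q + (p + q))) (g : pseudo_metric M)
    (D : connection M)
    (hn : (2 <= p + q)%N) (hD : levi_civita g D) :
  [/\ forall (o : option (orientation M)) (s : bool),
        star_condition g D o <-> compatible g D o s,
      forall o : option (orientation M),
        (o = None \/ (3 <= p + q)%N) ->
        (star_condition g D o <-> weyl_vanishes g D)
    & forall o : orientation M, (p + q)%N = 2%N ->
        (((p, q) = (2%N, 0%N) \/ (p, q) = (0%N, 2%N)) ->
          (star_condition g D (Some o) <-> weyl_self_dual g D o)) /\
        ((p, q) = (1%N, 1%N) ->
          (star_condition g D (Some o) <-> weyl_anti_self_dual g D o))].
Proof.
split.
- by move=> o s; apply: star_compatible.
- move=> o ho; split=> H pt a ha.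
    by apply: (star_at_weyl_zero hD ha hn ho); apply/star_at_point; apply: H.
  by apply/star_at_point/(weyl_zero_star_at hD ha hn); apply: H.
- move=> o n2.
  have h0 : (0 < p + q)%N by rewrite n2.
  have key t : t = - (Ipq R p q (Ordinal h0) (Ordinal h0)
      * Ipq R p q (Ordinal hn) (Ordinal hn)) -> _ :=
    @star_hodge_condition _ _ _ _ _ _ hD o t (Ordinal h0) (Ordinal hn) n2 erefl erefl.
  split=> [[|]|] E; apply: key; case: E => ? ?; subst.
  + by rewrite !Ipq_lt // mulr1.
  + by rewrite !Ipq_ge // mulrNN mulr1.
  + by rewrite Ipq_lt // Ipq_ge // mul1r opprK.
Qed.
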